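(* Let $\alpha \in \mathbb{R}$ and $p,q \in (0, \infty]$. Suppose that $A, B \in \mathrm{GL}(d, \mathbb{R})$ are expansive matrices that are equivalent and satisfy $|\det (A)|=|\det (B)|$. Then, for each $j\in \mathbb{Z}$, there exists a bijection $\pi_j: \mathbb{Z}^d \to \mathbb{Z}^d$ such that the induced permutation operator $P: \mathbb{C}^{\mathbb{Z} \times \mathbb{Z}^d} \to \mathbb{C}^{\mathbb{Z} \times \mathbb{Z}^d}$ respecting scales, defined by \[ P\big( (c_{j,k})_{j\in \mathbb{Z}, k\in \mathbb{Z}^d}\big) = \big(c_{j,\pi_j^{-1}(k)}\big)_{j\in \mathbb{Z}, k\in \mathbb{Z}^d}, \] is an isomorphism between the spaces $\dot{\mathbf f}^\alpha_{p,q}(A)$ and $\dot{\mathbf f}^\alpha_{p,q}(B)$. That is, $P$ is onto and there is a constant $C \geq 1$ such that \[ C^{-1}\|c\|_{\dot{\mathbf f}^\alpha_{p,q}(A)} \leq \|P(c)\|_{\dot{\mathbf f}^\alpha_{p,q}(B)} \leq C \|c\|_{\dot{\mathbf f}^\alpha_{p,q}(A)} \] for all $c\in \mathbb{C}^{\mathbb{Z} \times \mathbb{Z}^d}$.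
   Context: A matrix $A \in \mathrm{GL}(d,\mathbb{R})$ is expansive if all its eigenvalues $\lambda$ satisfy $|\lambda|>1$. A homogeneous quasi-norm associated with an expansive matrix $A$ is a Borel measurable function $\rho_A:\mathbb{R}^d\to[0,\infty)$ such that (i) $\rho_A(x)>0$ for $x\neq 0$; (ii) $\rho_A(Ax)=|\det(A)|\rho_A(x)$ for all $x\in\mathbb{R}^d$; (iii) there is $c>0$ with $\rho_A(x+y)\le c(\rho_A(x)+\rho_A(y))$ for all $x,y\in\mathbb{R}^d$. Any two homogeneous quasi-norms associated with the same $A$ are equivalent (each is bounded by a constant multiple of the other). Two expansive matrices $A$ and $B$ are called equivalent if associated homogeneous quasi-norms $\rho_A$ and $\rho_B$ are equivalent, i.e. there is $C\ge 1$ with $C^{-1}\rho_A(x)\le\rho_B(x)\le C\rho_A(x)$ for all $x\in\mathbb{R}^d$. For an expansive matrix $A$, $\alpha\in\mathbb{R}$ and $p,q\in(0,\infty]$, the anisotropic Triebel-Lizorkin sequence space $\dot{\mathbf f}^\alpha_{p,q}(A)$ is the space of all $c=(c_{j,k})\in\mathbb{C}^{\mathbb{Z}\times\mathbb{Z}^d}$ with $\|c\|_{\dot{\mathbf f}^\alpha_{p,q}(A)}<\infty$, where the quasi-norm (with values in $[0,\infty]$) is defined as follows. For $p<\infty$, \[ \|c\|_{\dot{\mathbf f}^\alpha_{p,q}(A)}:=\bigg\|\bigg(\sum_{j\in\mathbb{Z}}\sum_{k\in\mathbb{Z}^d}\big(|\det(A)|^{-j(\alpha+1/2)}|c_{j,k}|\mathbf{1}_{A^j([0,1]^d+k)}\big)^q\bigg)^{1/q}\bigg\|_{L^p(\mathbb{R}^d)},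 \] with the usual modification (supremum over $(j,k)$) for $q=\infty$. For $p=\infty$, $q<\infty$, \[ \|c\|_{\dot{\mathbf f}^\alpha_{\infty,q}(A)}:=\sup_{P\in\mathcal{Q}}\bigg(\frac1{|P|}\int_P\sum_{j\in\mathbb{Z},\,j\le \operatorname{scale}(P)}\sum_{k\in\mathbb{Z}^d}\big(|\det(A)|^{-j(\alpha+1/2)}|c_{j,k}|\mathbf{1}_{A^j([0,1]^d+k)}(x)\big)^q\,dx\bigg)^{1/q}, \] where $\mathcal{Q}=\{A^j([0,1]^d+k):j\in\mathbb{Z},k\in\mathbb{Z}^d\}$ and $\operatorname{scale}(A^j([0,1]^d+k))=j$. For $p=q=\infty$, $\|c\|_{\dot{\mathbf f}^\alpha_{\infty,\infty}(A)}:=\sup_{j\in\mathbb{Z},k\in\mathbb{Z}^d}|\det(A)|^{-j(\alpha+1/2)}|c_{j,k}|$. *)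

(* Defs.v *)
From HB Require Import structures.
From mathcomp Require Import all_boot all_order all_algebra.
From mathcomp Require Import all_classical all_reals all_analysis.
From mathcomp.real_closed Require Import complex.

Set Implicit Arguments.
Unset Strict Implicit.
Unset Printing Implicit Defensive.

Import Order.TTheory GRing.Theory Num.Theory.
Import numFieldNormedType.Exports.

Local Open Scope classical_set_scope.
Local Open Scope ring_scope.
Local Open Scope complex_scope.

Section image_measure.
Context d1 d2 (T1 : measurableType d1) (T2 : measurableType d2) (R : realType).
Variables (m : {measure set T1 -> \bar R}) (f : T1 -> T2).
Hypothesis mf : measurable_fun setT f.

Let im := pushforward m f.

Let im0 : im set0 = 0%E. Proof. exact: measure0. Qed.

Let im_ge0 A : (0 <= im A)%E. Proof. exact: measure_ge0. Qed.

Let im_sigma_additive : semi_sigma_additive im.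
Proof. exact: measure_semi_sigma_additive. Qed.

HB.instance Definition _ := isMeasure.Build _ _ _ im
  im0 im_ge0 im_sigma_additive.

Definition image_measure : {measure set T2 -> \bar R} := im.

End image_measure.

Section lebesgue_tuple.
Variable R : realType.
Local Notation RT := (measurableTypeR R).

Definition cons_pair (n : nat) (z : RT * n.-tuple RT) : n.+1.-tuple RT :=
  [tuple of z.1 :: z.2].

Lemma measurable_cons_pair (n : nat) :
  measurable_fun [set: RT * n.-tuple RT] (@cons_pair n).
Proof. exact: measurable_cons. Qed.

Section step.
Variables (n : nat) (m : {sigma_finite_measure set (n.-tuple RT) -> \bar R}).

Definition lebesgue_tuple_step : set (n.+1.-tuple RT) -> \bar R :=
  image_measure (@lebesgue_measure R \x m)%E (@measurable_cons_pair n).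

HB.instance Definition _ := Measure.on lebesgue_tuple_step.

Let step_sigma_finite : sigma_finite setT lebesgue_tuple_step.
Proof.
pose u (t : n.+1.-tuple RT) : RT * n.-tuple RT := (thead t, [tuple of behead t]).
have mu : measurable_fun setT u.
  apply/measurable_fun_pairP; split; first exact: measurable_tnth.
  exact: measurable_behead.
have /sigma_finiteP[F [TF ndF Foo]] := sigma_finiteT (@lebesgue_measure R).
have /sigma_finiteP[G [TG ndG Goo]] := sigma_finiteT m.
exists (fun k => u @^-1` (F k `*` G k)).
  rewrite -preimage_bigcup (_ : \bigcup_k _ = setT) ?preimage_setT//.
  apply/seteqP; split=> // -[x y] _.
  have [[i _ Fx] [j _ Gy]] : (\bigcup_i F i) x /\ (\bigcup_i G i) y.
    by rewrite -TF -TG.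
  exists (maxn i j) => //; split => /=.
  - by move: x Fx; exact/subsetPset/ndF/leq_maxl.
  - by move: y Gy; exact/subsetPset/ndG/leq_maxr.
move=> k; have [mF Fk] := Foo k; have [mG Gk] := Goo k; split.
  by rewrite -[X in measurable X]setTI; apply: mu => //; exact: measurableX.
rewrite /lebesgue_tuple_step /= /pushforward -comp_preimage.
rewrite (_ : u \o _ = id); last first.
  apply/funext => -[x t] /=.
  by rewrite /u /cons_pair theadE; congr pair; exact: val_inj.
by rewrite preimage_id product_measure1E// lte_mul_pinfty// ge0_fin_numE.
Qed.

HB.instance Definition _ := Measure_isSigmaFinite.Build _ _ _
  lebesgue_tuple_step step_sigma_finite.

End step.

(* Lebesgue measure on R ^ n as an iterated product, starting from the Dirac
   mass on R ^ 0. *)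
Fixpoint lebesgue_tuple (n : nat) :
    {sigma_finite_measure set (n.-tuple RT) -> \bar R} :=
  match n with
  | 0 => \d_([tuple] : 0.-tuple RT)
  | n.+1 => lebesgue_tuple_step (lebesgue_tuple n)
  end.

End lebesgue_tuple.

Definition borel_cV (R : realType) (n : nat) :=
  g_sigma_algebraType (@open 'cV[R]_n).

Section lebesgue_cV.
Variables (R : realType) (n : nat).
Local Notation RT := (measurableTypeR R).

Definition cV_of_tuple (t : n.-tuple RT) : borel_cV R n :=
  \col_(i < n) (tnth t i : R).

Lemma measurable_cV_of_tuple : measurable_fun setT cV_of_tuple.
Proof.
pose bx (p : n.-tuple rat * rat) : set 'cV[R]_n :=
  [set v | forall i, `|ratr (tnth p.1 i) - v i 0| < ratr p.2].
have mbx p : measurable (cV_of_tuple @^-1` bx p).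
  rewrite (_ : _ @^-1` _ = \bigcap_(i in [set: 'I_n])
      ((fun t : n.-tuple RT => tnth t i : RT) @^-1`
        ball (ratr (tnth p.1 i) : R) (ratr p.2))); last first.
    apply/seteqP; split=> [t pt i _|t pt i].
      by have := pt i; rewrite mxE.
    by rewrite mxE; exact: pt.
  apply: fin_bigcap_measurable => // i _.
  rewrite -[X in measurable X]setTI; apply: measurable_tnth => //.
  exact: measurable_realfun.measurable_ball.
apply: (@measurability _ _ _ (borel_cV R n) _ _ (@open 'cV[R]_n)) => //.
move=> _ [U oU <-]; rewrite setTI.
have -> : U = \bigcup_(p in [set p | bx p `<=` U]) bx p.
  apply/seteqP; split=> [v Uv|v [p pU]]; last exact: pU.
  have /nbhs_ballP[e /= e0 eU] : nbhs v U by exact: open_nbhs_nbhs.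
  have [r rr] : exists r : rat, (0 : R) < ratr r < e / 2.
    have [r] := rat_in_itvoo (divr_gt0 e0 (ltr0n _ 2)).
    by rewrite in_itv /= => ?; exists r.
  move: rr => /andP[r0 re].
  have qP (i : 'I_n) : {q : rat | `|ratr q - v i 0| < ratr r}.
    apply: cid; have [q] : exists q : rat, v i 0 - ratr r < ratr q < v i 0 + ratr r.
      have [|q] := @rat_in_itvoo R (v i 0 - ratr r) (v i 0 + ratr r).
        by rewrite ltrD2l gtrN.
      by rewrite in_itv /= => ?; exists q.
    by exists q; rewrite distrC ltr_distlC.
  pose p := ([tuple projT1 (qP i) | i < n], r).
  exists p => /=; last by move=> i; rewrite tnth_mktuple; case: (qP i).
  move=> w pw; apply: eU; split=> // i j; rewrite ord1.
  rewrite /ball /= -(subrKA (ratr (tnth p.1 i))) (splitr e).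
  rewrite (le_lt_trans (ler_normD _ _))// ltrD//.
    by rewrite distrC (lt_trans _ re)// tnth_mktuple; case: (qP i).
  by rewrite (lt_trans (pw i)).
rewrite preimage_bigcup bigcup_mkcond.
apply: countable_bigcupT_measurable => [|p]; first exact: countableP.
by case: ifP.
Qed.

Definition lebesgue_cV : {measure set (borel_cV R n) -> \bar R} :=
  image_measure (lebesgue_tuple R n) measurable_cV_of_tuple.

End lebesgue_cV.

Section expansive.
Variables (R : realType) (n : nat).
Implicit Types (A B : 'M[R]_n) (rho : 'cV[R]_n -> R).

Definition expansive A := forall lambda : R[i],
  eigenvalue (map_mx (real_complex R) A) lambda -> 1 < `|lambda|.

Record homogeneous_quasi_norm A rho : Prop := HomogeneousQuasiNorm {
  hqn_measurable : measurable_fun setT (rho : borel_cV R n -> measurableTypeR R);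
  hqn_ge0 : forall x, 0 <= rho x;
  hqn_gt0 : forall x, x != 0 -> 0 < rho x;
  hqn_homogeneous : forall x, rho (A *m x) = `|\det A| * rho x;
  hqn_quasi_triangle : exists2 c : R, 0 < c &
    forall x y, rho (x + y) <= c * (rho x + rho y) }.

Definition equivalent_quasi_norms rho1 rho2 := exists2 C : R, 1 <= C &
  forall x, C^-1 * rho1 x <= rho2 x <= C * rho1 x.

Definition equivalent_matrices A B := exists rhoA rhoB,
  [/\ homogeneous_quasi_norm A rhoA, homogeneous_quasi_norm B rhoB &
      equivalent_quasi_norms rhoA rhoB].

End expansive.

Section triebel_lizorkin.
Variables (R : realType) (n : nat).
(* The ambient dimension is n.+1, so that square matrices form a unit ring and
   A ^ j makes sense for j : int. *)
Local Notation Rd := 'cV[R]_n.+1.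
Local Notation Zd := 'cV[int]_n.+1.
Local Notation mu := (lebesgue_cV R n.+1).

Definition coef_seq := int * Zd -> R[i].

Definition unit_cube : set Rd := [set x | forall i, 0 <= x i 0 <= 1].

Definition dilated_cube (A : 'M[R]_n.+1) (j : int) (k : Zd) : set Rd :=
  [set A ^ j *m (x + map_mx intr k) | x in unit_cube].

Implicit Types (A : 'M[R]_n.+1) (alpha : R) (c : coef_seq).

Definition weighted_coef A alpha c (j : int) (k : Zd) : R :=
  `|\det A| `^ (- (j%:~R * (alpha + 2^-1))) * ComplexField.Normc.normc (c (j, k)).

Definition weighted_term A alpha c (j : int) (k : Zd) (x : Rd) : R :=
  weighted_coef A alpha c j k * \1_(dilated_cube A j k) x.

Local Open Scope ereal_scope.

(* The pair (l, m) stands for the cube P = A ^ l ([0, 1]^d + m), of scale l. *)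
Definition tl_cube_mean A alpha (q : R) c (l : int) (m : Zd) : \bar R :=
  (fine (mu (dilated_cube A l m)))^-1%:E *
  \int[mu]_(x in dilated_cube A l m)
    \esum_(j in [set j : int | (j <= l)%R]) \esum_(k in [set: Zd])
      (weighted_term A alpha c j k x `^ q)%:E.

(* The -oo cases are junk values: the exponents range over ]0, +oo]. *)
Definition tl_norm A alpha (p q : \bar R) c : \bar R :=
  match p, q with
  | p%:E, q%:E => Lnorm mu p%:E (fun x =>
      (\esum_(j in [set: int]) \esum_(k in [set: Zd])
        (weighted_term A alpha c j k x `^ q)%:E) `^ q^-1)
  | p%:E, +oo => Lnorm mu p%:E (fun x =>
      ereal_sup [set (weighted_term A alpha c jk.1 jk.2 x)%:E | jk in [set: int * Zd]])
  | +oo, q%:E =>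
      ereal_sup [set tl_cube_mean A alpha q c lm.1 lm.2 `^ q^-1 | lm in [set: int * Zd]]
  | +oo, +oo =>
      ereal_sup [set (weighted_coef A alpha c jk.1 jk.2)%:E | jk in [set: int * Zd]]
  | _, _ => 0
  end.

Definition tl_space A alpha (p q : \bar R) : set coef_seq :=
  [set c | tl_norm A alpha p q c < +oo].

(* pi_inv j is the inverse of the permutation pi_j: the coefficient c_(j, k) is
   moved to position (j, pi_j k). *)
Definition scale_permutation (pi_inv : int -> Zd -> Zd) c : coef_seq :=
  fun jk => c (jk.1, pi_inv jk.1 jk.2).

End triebel_lizorkin.

(* Main.v *)
Require Import Defs.
From mathcomp Require Import all_boot all_order all_algebra.
From mathcomp Require Import all_classical all_reals all_analysis measurable_realfun.
From mathcomp Require Import ring lra perm.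
From mathcomp.real_closed Require Import complex.

Set Implicit Arguments.
Unset Strict Implicit.
Unset Printing Implicit Defensive.

Import Order.TTheory GRing.Theory Num.Theory.
Import numFieldNormedType.Exports.

Local Open Scope classical_set_scope.
Local Open Scope ring_scope.

(** Call A^j([0,1]^d + k) the A-cube of scale j at k. The proof has a geometric
half, which constructs the permutations, and an analytic half, which shows that
replacing every A-cube by a set of comparable size and position changes the
norms by bounded factors only.

Geometry. If rhoA and rhoB are equivalent and |det A| = |det B|, homogeneity
bounds rhoA (A^-j B^j e) by a quantity that does not depend on j, for every
basis vector e. Sublevel sets of a homogeneous quasi-norm are bounded
([hqn_sublevel_bounded]), so the matrices A^-j B^j, and symmetrically
T_j = B^-j A^j, stay in a bounded set ([equivalent_matrices_bounded]).
A matrix of determinant 1 or -1 in a bounded set is a product of boundedly many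
shears of bounded size, by Gaussian elimination, and a shear
(x, y) |-> (x, y + h x) is at distance at most 1 from the permutation
(k, l) |-> (k, l + floor (h k)) of Z^d. Hence T_j is uniformly close to a
permutation pi_j of Z^d ([uniformly_near_det1]), which means that the B-cube of
scale j at pi_j k lies in a fixed dilate of the A-cube of scale j at k, and
conversely ([cubes_comparable]).

Analysis, p < oo. The usual argument is the vector-valued maximal inequality of
Fefferman and Stein; here a laminar family of hulls replaces it. The cubes are
split into finitely many colours, so that two cubes of one colour are far apart
if they have the same scale, and otherwise have very different scales. Within a
colour, the dilates V of finitely many cubes Q can be enlarged to hulls U that
are pairwise nested or disjoint, with |U| <= D |Q| ([laminar_hulls]). Let
F = sum a 1_Q and G = sum a 1_U, and add the cubes one by one, the smallest
last. The earlier part of G is constant on the hull that is being added, which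
allows one to follow the two integrals: for t <= 1 concavity of the power gives
int G^t <= D int F^t, and for t >= 1 one gets int G^t <= C int F G^(t-1), from
which Young's inequality removes G ([laminar_integral_le1],
[laminar_integral_ge1]). With t = p / q this is the case q < oo, after a passage
from finite to infinite families by monotone convergence. For t <= 1 the
constant does not depend on t, so that a supremum over m cubes can be replaced
by an l^q norm with q depending on m, which settles q = oo.

Analysis, p = oo. Only the cubes that meet P contribute to the mean over a cube
P, and those that are not larger than P have their partners in a fixed number of
neighbours of P of the same scale ([tl_norm_transfer_inf_fin]). *)

(** * Entrywise bounds and decay of the negative powers of an expansive matrix *)

Section entrywise_bounds.
Variable R : realType.

(** The entrywise bound is used instead of an operator norm because it makes sense
for rectangular matrices; the price is the factor n in [mx_boundedM]. *)
Definition mx_bounded (m n : nat) (r : R) (M : 'M[R]_(m, n)) :=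
  forall i j, `|M i j| <= r.

Lemma mx_boundedD (m n : nat) (r s : R) (M N : 'M[R]_(m, n)) :
  mx_bounded r M -> mx_bounded s N -> mx_bounded (r + s) (M + N).
Proof. by move=> Mr Ns i j; rewrite mxE (le_trans (ler_normD _ _))// lerD. Qed.

Lemma mx_boundedN (m n : nat) (r : R) (M : 'M[R]_(m, n)) :
  mx_bounded r M -> mx_bounded r (- M).
Proof. by move=> Mr i j; rewrite mxE normrN. Qed.

Lemma mx_boundedB (m n : nat) (r s : R) (M N : 'M[R]_(m, n)) :
  mx_bounded r M -> mx_bounded s N -> mx_bounded (r + s) (M - N).
Proof. by move=> Mr Ns; apply: mx_boundedD => //; exact: mx_boundedN. Qed.

Lemma mx_boundedW (m n : nat) (r s : R) (M : 'M[R]_(m, n)) :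
  r <= s -> mx_bounded r M -> mx_bounded s M.
Proof. by move=> rs Mr i j; exact: le_trans (Mr i j) rs. Qed.

Lemma mx_boundedM (m n p : nat) (r s : R) (M : 'M[R]_(m, n)) (N : 'M[R]_(n, p)) :
  mx_bounded r M -> mx_bounded s N -> mx_bounded (n%:R * r * s) (M *m N).
Proof.
move=> Mr Ns i j; rewrite mxE (le_trans (ler_norm_sum _ _ _))//.
rewrite -mulrA mulr_natl -[n in _ *+ n]card_ord -sumr_const.
by apply: ler_sum => k _; rewrite normrM ler_pM.
Qed.

Lemma mx_bounded_exists (m n : nat) (M : 'M[R]_(m, n)) :
  exists2 r : R, 0 <= r & mx_bounded r M.
Proof.
exists (\sum_i \sum_j `|M i j|); first by apply: sumr_ge0 => i _; apply: sumr_ge0.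
move=> i j; rewrite (bigD1 i)//= (bigD1 j)//= -addrA lerDl addr_ge0//.
  exact: sumr_ge0.
by apply: sumr_ge0 => k _; apply: sumr_ge0.
Qed.

Lemma det_bounded (n : nat) (r : R) (M : 'M[R]_n) :
  mx_bounded r M -> `|\det M| <= n`!%:R * r ^+ n.
Proof.
move=> Mr; rewrite (le_trans (ler_norm_sum _ _ _))//.
have -> : n`!%:R * r ^+ n = \sum_(s : 'S_n) r ^+ n.
  by rewrite sumr_const card_Sn mulr_natl.
apply: ler_sum => s _; rewrite normrM normrX normrN1 expr1n mul1r normr_prod.
rewrite -[n in r ^+ n]card_ord -prodr_const.
by apply: ler_prod => i _; rewrite normr_ge0 Mr.
Qed.

End entrywise_bounds.

Section expansive_decay.
Variable R : realType.
Local Notation nrm := (@ComplexField.Normc.normc R).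

Definition decays (b : nat -> R) :=
  exists C g : R, [/\ 0 <= C, 0 < g < 1 & forall k, b k <= C * g ^+ k].

(** For a rate h with 1/l < h < 1 and g < h, the bound D h^k propagates along the
recursion as soon as D (h l - 1) >= C. *)
Lemma decays_recursion (b e : nat -> R) (l : R) :
  1 < l -> decays e -> (forall k, 0 <= b k) ->
  (forall k, b k.+1 <= (b k + e k) / l) -> decays b.
Proof.
move=> l1 [C [g [C0 /andP[g0 g1] eC]]] b0 bS.
have l0 : 0 < l by rewrite (lt_trans _ l1).
pose h := Num.max ((1 + l^-1) / 2) ((1 + g) / 2).
have li1 : l^-1 < 1 by rewrite invf_lt1.
have li0 : 0 < l^-1 by rewrite invr_gt0.
have h1 : h < 1 by rewrite gt_max; apply/andP; split; lra.
have lh : l^-1 < h by rewrite lt_max; apply/orP; left; lra.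
have gh : g < h by rewrite lt_max; apply/orP; right; lra.
have h0 : 0 < h by rewrite (lt_trans g0).
have hl : 1 < h * l by rewrite -ltr_pdivrMr// div1r.
pose D := b 0%N + C / (h * l - 1).
have D0 : 0 <= D by rewrite addr_ge0// divr_ge0// subr_ge0 ltW.
exists D, h; split => //; first by rewrite h0.
elim=> [|k IH]; first by rewrite expr0 mulr1 lerDl divr_ge0// subr_ge0 ltW.
apply: (le_trans (bS k)); rewrite ler_pdivrMr//.
have -> : D * h ^+ k.+1 * l = D * (h * l) * h ^+ k by rewrite exprSr; ring.
have : e k <= C * h ^+ k.
  by apply: (le_trans (eC k)); rewrite ler_wpM2l// lerXn2r// ?nnegrE ltW.
move=> ek; apply: (@le_trans _ _ (D * h ^+ k + C * h ^+ k)); first exact: lerD.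
rewrite -mulrDl; apply: ler_wpM2r; first by rewrite exprn_ge0// ltW.
have -> : D * (h * l) = D + D * (h * l - 1) by rewrite mulrBr mulr1 addrCA subrr addr0.
rewrite lerD2l /D mulrDl divfK ?gt_eqF ?subr_gt0// lerDr.
by rewrite mulr_ge0// subr_ge0 ltW.
Qed.

Lemma decays_shift (b : nat -> R) : decays b -> decays (fun k => b k.+1).
Proof.
move=> [C [g [C0 g01 bC]]]; exists (C * g), g; split => //.
  by case/andP: g01 => g0 _; rewrite mulr_ge0// ltW.
by move=> k; rewrite -mulrA -exprS.
Qed.

Lemma decays_small (b : nat -> R) (e : R) :
  decays b -> 0 < e -> exists2 N, (0 < N)%N & forall k, (N <= k)%N -> b k <= e.
Proof.
move=> [C [g [C0 /andP[g0 g1] bC]]] e0.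
have : (fun k => C * g ^+ k) @ \oo --> C * 0.
  by apply: cvgM; [exact: cvg_cst|apply: cvg_expr; rewrite gtr0_norm].
rewrite mulr0 => /cvgrPdist_le /(_ _ e0)[N _ NP].
exists N.+1 => // k Nk; apply: (le_trans (bC k)).
have := NP k (ltnW Nk); rewrite sub0r normrN; exact/le_trans/ler_norm.
Qed.

Let mx_sum_normc (m n : nat) (M : 'M[R[i]]_(m, n)) : R := \sum_i \sum_j nrm (M i j).

Let nrm_ge0 z : 0 <= nrm z.
Proof. by case: z => x y; exact: sqrtr_ge0. Qed.

Let mx_sum_normc_ge0 (m n : nat) (M : 'M[R[i]]_(m, n)) : 0 <= mx_sum_normc M.
Proof. by apply: sumr_ge0 => i _; apply: sumr_ge0 => j _; exact: nrm_ge0. Qed.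

(** The vectors u_k = q(A) A^-k and v_k = ((X - z) q)(A) A^-k satisfy
z u_(k+1) = u_k - v_(k+1), and |z| > 1, so the decay of v implies that of u.
Thus the factors of a polynomial can be removed one at a time. *)
Let decays_factor (n : nat) (A : 'M[R[i]]_n.+1) (s : seq R[i]) :
  A \is a GRing.unit -> (forall z, z \in s -> 1 < nrm z) ->
  let u q k := mx_sum_normc (horner_mx A q * A ^- k) in
  decays (u (\prod_(z <- s) ('X - z%:P))) -> decays (u 1).
Proof.
move=> Au s1 u; elim: s s1 => [|z s IH] s1; first by rewrite big_nil.
rewrite big_cons; set q := \prod_(_ <- _) _ => zqD.
apply: IH => [w ws|]; first by apply: s1; rewrite inE ws orbT.
rewrite -/q; apply: (decays_recursion (s1 z (mem_head _ _)) (decays_shift zqD)) => [k|k].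
  exact: mx_sum_normc_ge0.
have z0 : 0 < nrm z by rewrite (lt_trans _ (s1 z (mem_head _ _))).
rewrite ler_pdivlMr// mulrC /u.
have AA : A * A ^- k.+1 = A ^- k by rewrite exprSr invrM ?unitrX// mulVKr.
have E : z *: (horner_mx A q * A ^- k.+1) =
    horner_mx A q * A ^- k - horner_mx A (('X - z%:P) * q) * A ^- k.+1.
  rewrite [(_ - _) * q]mulrC rmorphM rmorphB /= horner_mx_X horner_mx_C -mulrA.
  rewrite mulrBl AA mulrBr opprB addrC subrK -scalemx1.
  by rewrite -[(1%:M)%R]/(1%R : 'M[R[i] ]_n.+1) -scalerAl mul1r -scalerAr.
rewrite /mx_sum_normc mulr_sumr -big_split /=; apply: ler_sum => i _.
rewrite mulr_sumr -big_split /=; apply: ler_sum => j _.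
rewrite -ComplexField.Normc.normcM.
have -> : z * (horner_mx A q * A ^- k.+1) i j =
    (horner_mx A q * A ^- k) i j - (horner_mx A (('X - z%:P) * q) * A ^- k.+1) i j.
  by have /matrixP /(_ i j) := E; rewrite mxE => ->; rewrite !mxE.
by rewrite -[X in _ <= _ + X]normcN; exact: le_normcD.
Qed.

(** By Cayley-Hamilton the product of all A - z, over the complex eigenvalues z, is
zero and therefore decays; [decays_factor] removes all the factors and leaves the
decay of A^-k itself. *)
Lemma expansive_pow_small (n : nat) (A : 'M[R]_n.+1) (e : R) :
  A \in unitmx -> expansive A -> 0 < e ->
  exists2 L : nat, (0 < L)%N & forall k, (L <= k)%N -> mx_bounded e (A ^- k).
Proof.
move=> Au expA e0; set Ac : 'M[R[i]]_n.+1 := map_mx (real_complex R) A.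
have Acu : Ac \is a GRing.unit by rewrite -[_ \is a _]/(Ac \in unitmx) map_unitmx.
have [s] := closed_field_poly_normal (char_poly Ac).
rewrite (monicP (char_poly_monic _)) scale1r => sE.
have s1 z : z \in s -> 1 < nrm z.
  move=> zs; have : eigenvalue Ac z.
    by rewrite eigenvalue_root_char sE root_prod_XsubC.
  by move=> /expA; rewrite normc_def -(rmorph1 (real_complex R)) ltcR; case: (z).
have /= := @decays_factor _ Ac s Acu s1; rewrite -sE => D0.
have D : decays (fun k => mx_sum_normc (0 * Ac ^- k)) ->
    decays (fun k => mx_sum_normc (horner_mx Ac 1 * Ac ^- k)).
  by rewrite -(Cayley_Hamilton Ac).
have {D} /decays_small /(_ e0) [L L0 LP] : decays (fun k => mx_sum_normc (Ac ^- k)).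
  have -> : (fun k => mx_sum_normc (Ac ^- k)) =
      (fun k => mx_sum_normc (horner_mx Ac 1 * Ac ^- k)).
    by apply/funext => k; rewrite rmorph1 mul1r.
  apply: D; exists 0, 2^-1; split => //; first by apply/andP; split; lra.
  move=> k; rewrite mul0r mul0r /mx_sum_normc big1// => i _; rewrite big1// => j _.
  by rewrite mxE ComplexField.Normc.normc0.
exists L => // k /LP bk i j; apply: le_trans bk.
have -> : `|(A ^- k) i j| = nrm ((Ac ^- k) i j).
  have -> : Ac ^- k = map_mx (real_complex R) (A ^- k).
    by rewrite rmorphV ?unitrX//= rmorphXn.
  by rewrite mxE /= expr0n /= addr0 sqrtr_sqr.
rewrite /mx_sum_normc (bigD1 i)//= (bigD1 j)//= -addrA lerDl addr_ge0//.
  by apply: sumr_ge0 => *; exact: nrm_ge0.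
by apply: sumr_ge0 => *; apply: sumr_ge0 => *; exact: nrm_ge0.
Qed.

End expansive_decay.

(** * Matrices of determinant 1 or -1 are close to permutations of the integer lattice *)

Section near_lattice_bijections.
Variable R : realType.
Local Notation toR := (map_mx (intr : int -> R)).

Definition near_bijection (n : nat) (r : R) (T : 'M[R]_n) :=
  exists f g : 'cV[int]_n -> 'cV[int]_n, [/\ cancel f g, cancel g f &
    forall k, mx_bounded r (T *m toR k - toR (f k))].

(** The same constant serves for the whole class [P]: the permutations pi_j must be
close to the matrices T_j uniformly in j. *)
Definition uniformly_near (n : nat) (P : 'M[R]_n -> Prop) :=
  exists r : R, forall T, P T -> near_bijection r T /\ mx_bounded r T.

(** If f1 and f2 approximate S1 and S2, then f1 o f2 approximates S1 S2: the error
of f2 is multiplied by the bound on S1. *)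
Lemma uniformly_nearM (n : nat) (P Q : 'M[R]_n -> Prop) :
  uniformly_near P -> uniformly_near Q ->
  uniformly_near (fun T => exists S1 S2, [/\ P S1, Q S2 & T = S1 *m S2]).
Proof.
move=> [r Pr] [s Qs]; exists (Num.max (n%:R * r * s + r) (n%:R * r * s)).
move=> _ [S1 [S2 [/Pr[[f1 [g1 [fg1 gf1 S1f1]]] S1r] /Qs[[f2 [g2 [fg2 gf2 S2f2]]] S2s] ->]]].
split; last first.
  by apply: mx_boundedW (mx_boundedM S1r S2s); rewrite le_max lexx orbT.
exists (f1 \o f2), (g2 \o g1); split; [exact: can_comp|exact: can_comp|move=> k].
apply: (@mx_boundedW _ _ _ (n%:R * r * s + r)); first by rewrite le_max lexx.
rewrite (_ : _ - _ = S1 *m (S2 *m toR k - toR (f2 k)) +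
    (S1 *m toR (f2 k) - toR (f1 (f2 k)))).
  by apply: mx_boundedD; [apply: mx_boundedM|].
by rewrite mulmxBr mulmxA addrA subrK.
Qed.

Let fl (n : nat) (x : 'cV[R]_n) : 'cV[int]_n := map_mx Num.floor x.

Let fl_near (n : nat) (x : 'cV[R]_n) : mx_bounded 1 (x - toR (fl x)).
Proof.
move=> i j; rewrite !mxE ger0_norm; last by rewrite subr_ge0 floor_le_tmp.
by rewrite lerBlDl -[X in _ + X]/(1%:~R) -intrD ltW// floorD1_gt.
Qed.

Definition lower_shear (n : nat) (v : 'cV[R]_n) : 'M[R]_(1 + n) :=
  block_mx 1%:M 0 v 1%:M.
Definition upper_shear (n : nat) (u : 'rV[R]_n) : 'M[R]_(1 + n) :=
  block_mx 1%:M u 0 1%:M.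
Definition bordered (n : nat) (W : 'M[R]_n) : 'M[R]_(1 + n) :=
  block_mx 1%:M 0 0 W.

Let mx_bounded1 (n : nat) : mx_bounded 1 (1%:M : 'M[R]_n).
Proof. by move=> i j; rewrite mxE; case: eqP => _; rewrite ?normr1 ?normr0. Qed.

Let mx_bounded0 (m n : nat) (r : R) : 0 <= r -> mx_bounded r (0 : 'M[R]_(m, n)).
Proof. by move=> r0 i j; rewrite mxE normr0. Qed.

Lemma mx_bounded_col (m1 m2 n : nat) (r : R) (M : 'M[R]_(m1, n)) (N : 'M[R]_(m2, n)) :
  mx_bounded r M -> mx_bounded r N -> mx_bounded r (col_mx M N).
Proof. by move=> Mr Nr i j; rewrite mxE; case: splitP => k _. Qed.

Lemma mx_bounded_block (m1 m2 n1 n2 : nat) (r : R) (M1 : 'M[R]_(m1, n1)) M2 M3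
    (M4 : 'M[R]_(m2, n2)) :
  mx_bounded r M1 -> mx_bounded r M2 -> mx_bounded r M3 -> mx_bounded r M4 ->
  mx_bounded r (block_mx M1 M2 M3 M4).
Proof.
move=> h1 h2 h3 h4; apply: mx_bounded_col => i j.
  by rewrite mxE; case: splitP => k _.
by rewrite mxE; case: splitP => k _.
Qed.

(** The map (k, l) |-> (k, l + floor (v k)) is invertible because k is kept, and the
only error is the fractional part of v k. *)
Lemma uniformly_near_lower (n : nat) (K : R) :
  uniformly_near (fun T => exists2 v : 'cV[R]_n, mx_bounded K v & T = lower_shear v).
Proof.
exists (Num.max 1 K) => _ [v vK ->]; split; last first.
  apply: mx_bounded_block.
  - by apply: mx_boundedW (@mx_bounded1 _); rewrite le_max lexx.
  - by apply: mx_bounded0; rewrite le_max ler01.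
  - by apply: mx_boundedW vK; rewrite le_max lexx orbT.
  - by apply: mx_boundedW (@mx_bounded1 _); rewrite le_max lexx.
pose h (k : 'cV[int]_(1 + n)) := fl (v *m toR (usubmx k)).
exists (fun k => col_mx (usubmx k) (dsubmx k + h k)).
exists (fun k => col_mx (usubmx k) (dsubmx k - h k)); split.
- by move=> k; rewrite /h !col_mxKu !col_mxKd addrK vsubmxK.
- by move=> k; rewrite /h !col_mxKu !col_mxKd subrK vsubmxK.
move=> k; apply: (@mx_boundedW _ _ _ 1); first by rewrite le_max lexx.
rewrite -{1}[k]vsubmxK map_col_mx /lower_shear mul_block_col map_col_mx.
rewrite opp_col_mx add_col_mx; apply: mx_bounded_col.
  by rewrite mul1mx mul0mx addr0 subrr; exact: mx_bounded0.
by rewrite mul1mx map_mxD opprD addrA addrK.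
Qed.

Lemma uniformly_near_upper (n : nat) (K : R) :
  uniformly_near (fun T => exists2 u : 'rV[R]_n, mx_bounded K u & T = upper_shear u).
Proof.
exists (Num.max 1 K) => _ [v vK ->]; split; last first.
  apply: mx_bounded_block.
  - by apply: mx_boundedW (@mx_bounded1 _); rewrite le_max lexx.
  - by apply: mx_boundedW vK; rewrite le_max lexx orbT.
  - by apply: mx_bounded0; rewrite le_max ler01.
  - by apply: mx_boundedW (@mx_bounded1 _); rewrite le_max lexx.
pose h (k : 'cV[int]_(1 + n)) := fl (v *m toR (dsubmx k)).
exists (fun k => col_mx (usubmx k + h k) (dsubmx k)).
exists (fun k => col_mx (usubmx k - h k) (dsubmx k)); split.
- by move=> k; rewrite /h !col_mxKu !col_mxKd addrK vsubmxK.
- by move=> k; rewrite /h !col_mxKu !col_mxKd subrK vsubmxK.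
move=> k; apply: (@mx_boundedW _ _ _ 1); first by rewrite le_max lexx.
rewrite -{1}[k]vsubmxK map_col_mx /upper_shear mul_block_col map_col_mx.
rewrite opp_col_mx add_col_mx; apply: mx_bounded_col; last first.
  by rewrite mul1mx mul0mx add0r subrr; exact: mx_bounded0.
by rewrite mul1mx map_mxD opprD addrACA subrr add0r.
Qed.

Lemma uniformly_near_bordered (n : nat) (P : 'M[R]_n -> Prop) :
  uniformly_near P ->
  uniformly_near (fun T => exists2 W, P W & T = bordered W).
Proof.
move=> [r Pr]; exists (Num.max 1 r) => _ [W /Pr[[f [g [fg gf Wf]]] Wr] ->].
split; last first.
  apply: mx_bounded_block.
  - by apply: mx_boundedW (@mx_bounded1 _); rewrite le_max lexx.
  - by apply: mx_bounded0; rewrite le_max ler01.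
  - by apply: mx_bounded0; rewrite le_max ler01.
  - by apply: mx_boundedW Wr; rewrite le_max lexx orbT.
exists (fun k : 'cV[int]_(1 + n) => col_mx (usubmx k) (f (dsubmx k))).
exists (fun k : 'cV[int]_(1 + n) => col_mx (usubmx k) (g (dsubmx k))); split.
- by move=> k; rewrite !col_mxKu !col_mxKd fg vsubmxK.
- by move=> k; rewrite !col_mxKu !col_mxKd gf vsubmxK.
move=> k; rewrite -{1}[k]vsubmxK map_col_mx /bordered mul_block_col map_col_mx.
rewrite opp_col_mx add_col_mx mul1mx !mul0mx addr0 subrr add0r.
apply: mx_bounded_col; first by apply: mx_bounded0; rewrite le_max ler01.
by apply: mx_boundedW (Wf _); rewrite le_max lexx orbT.
Qed.

(** The cofactors are bounded, so all the entries of the first row cannot be small. *)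
Lemma large_entry_of_det1 (n : nat) (K : R) : exists2 d : R, 0 < d &
  forall T : 'M[R]_n.+1, mx_bounded K T -> `|\det T| = 1 ->
    exists j, d <= `|T 0 j|.
Proof.
pose C := n`!%:R * (Num.max 1 K) ^+ n.
have C0 : 0 < C by rewrite mulr_gt0 ?ltr0n ?fact_gt0// exprn_gt0// lt_max ltr01.
exists (n.+1%:R * C)^-1; first by rewrite invr_gt0 mulr_gt0.
move=> T TK detT; apply/existsP/contraT; rewrite negb_exists => /forallP small.
suff : `|\det T| < 1 by rewrite detT ltxx.
rewrite (expand_det_row T 0) (le_lt_trans (ler_norm_sum _ _ _))//.
have -> : 1 = \sum_(j < n.+1) (n.+1%:R^-1 : R).
  by rewrite sumr_const card_ord -[RHS]mulr_natl mulfV.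
apply: ltr_sum => [|j _]; first by apply/hasP; exists ord0; rewrite ?mem_index_enum.
have := small j; rewrite -ltNge normrM => Tj.
apply: (@le_lt_trans _ _ (`|T 0 j| * C)).
  apply: ler_wpM2l => //; rewrite normrM normrX normrN1 expr1n mul1r.
  apply: det_bounded => a b; rewrite !mxE (le_trans (TK _ _))//.
  by rewrite le_max lexx orbT.
by rewrite -ltr_pdivlMr// -invfM.
Qed.

(** A pivot equal to 1, and not merely nonzero, avoids the diagonal factors that
ordinary elimination produces, which are not close to permutations. If an entry
t_j of the first row with j > 0 is bounded below, adding (1 - t_0) / t_j times
column j to column 0 creates this pivot. If only t_0 is bounded below, column 0
is first added to the others. *)
Lemma shear_pivot (n : nat) (K : R) : exists M : R,
  forall T : 'M[R]_(1 + n.+1), mx_bounded K T -> `|\det T| = 1 ->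
    exists (u : 'rV[R]_n.+1) (v : 'cV[R]_n.+1),
      [/\ mx_bounded 1 u, mx_bounded M v &
        ulsubmx (T *m upper_shear u *m lower_shear v) = 1%:M].
Proof.
have [d d0 dP] := large_entry_of_det1 n.+1 K.
pose K' := K + K.
exists ((1 + K') / (d / 2)) => T TK detT.
have K0 : 0 <= K by exact: le_trans (normr_ge0 _) (TK 0 0).
have [u [j [u1 uj]]] : exists u : 'rV[R]_n.+1, exists j, mx_bounded 1 u /\
    d / 2 <= `|(ulsubmx T *m u + ursubmx T) 0 j|.
  have [[j jd]|noj] := pselect (exists j, d / 2 <= `|ursubmx T 0 j|).
    by exists 0, j; split; [exact: mx_bounded0|rewrite mulmx0 add0r].
  have T00 : d <= `|ulsubmx T 0 0|.
    have [i0] := dP T TK detT; case: (@split_ordP 1 n.+1 i0) => k -> Tk.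
      suff -> : ulsubmx T 0 0 = T 0 (lshift n.+1 k) by [].
      by rewrite !mxE; congr (T _ _); apply: val_inj => //=; rewrite [k]ord1.
    case: noj; exists k; rewrite !mxE.
    have -> : lshift n.+1 (0 : 'I_1) = 0 by exact: val_inj.
    by apply: le_trans Tk; lra.
  (* all the entries right of the first one are small: add column 0 to them *)
  exists (const_mx 1), 0; split; first by move=> a b; rewrite mxE normr1.
  rewrite mxE [(_ *m _) _ _]mxE big_ord1 [const_mx _ _ _]mxE mulr1.
  have T01 : `|ursubmx T 0 0| < d / 2 by rewrite ltNge; apply/negP => h; case: noj; exists 0.
  have := lerB_normD (ulsubmx T 0 0) (ursubmx T 0 0); lra.
have uK : `|(ulsubmx T *m u + ursubmx T) 0 j| <= K'.
  rewrite mxE [(_ *m _) _ _]mxE big_ord1 (le_trans (ler_normD _ _))// lerD//.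
    by rewrite normrM -[K]mulr1 ler_pM// !mxE.
  by rewrite !mxE.
set t := (ulsubmx T *m u + ursubmx T) in uj uK.
have t0 : t 0 j != 0 by rewrite -normr_gt0 (lt_le_trans _ uj)// divr_gt0.
exists u, (\col_i (if i == j then (1 - ulsubmx T 0 0) / t 0 j else 0)).
split => //.
  move=> i k; rewrite mxE; case: eqP => _; last first.
    by rewrite normr0 divr_ge0 ?addr_ge0// ?divr_ge0// ltW.
  rewrite normrM normfV; apply: ler_pM => //.
    rewrite (le_trans (ler_normB _ _))// normr1 lerD2l !mxE (le_trans (TK _ _))//.
    by rewrite lerDr.
  by rewrite lef_pV2// posrE ?(lt_le_trans _ uj)// divr_gt0.
rewrite -{1}[T]submxK /upper_shear /lower_shear !mulmx_block block_mxKul.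
rewrite !mulmx1 !mulmx0 addr0 -/t; apply/matrixP => a b; rewrite !ord1 mxE.
rewrite [(_ *m _) _ _]mxE (bigD1 j)//= big1 ?addr0.
  by rewrite [(\col__ _) _ _]mxE eqxx [X in _ + X]mulrC divfK// addrC subrK mxE eqxx.
by move=> i ij; rewrite [(\col__ _) _ _]mxE (negbTE ij) mulr0.
Qed.

Lemma shear_inv_lower (n : nat) (v : 'cV[R]_n) : lower_shear v *m lower_shear (- v) = 1%:M.
Proof.
by rewrite mulmx_block !mulmx1 !mul1mx !mulmx0 !mul0mx !addr0 !add0r subrr -scalar_mx_block.
Qed.

Lemma shear_inv_upper (n : nat) (u : 'rV[R]_n) : upper_shear u *m upper_shear (- u) = 1%:M.
Proof.
by rewrite mulmx_block !mulmx1 !mul1mx !mulmx0 !mul0mx !addr0 !add0r addrC subrr -scalar_mx_block.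
Qed.

(** Once the pivot is 1, two shears clear its row and its column and leave a smaller
block of determinant 1 or -1, with controlled entries. In dimension 1 the matrix
is 1 or -1 and acts on the integers. *)
Lemma uniformly_near_det1 (n : nat) (K : R) :
  uniformly_near (fun T : 'M[R]_n.+1 => mx_bounded K T /\ `|\det T| = 1).
Proof.
elim: n K => [|n IH] K.
  exists 1 => T [_]; rewrite det_mx11 => T1; split; last by move=> i j; rewrite !ord1 T1.
  exists (fun k => if T 0 0 == 1 then k else - k).
  exists (fun k => if T 0 0 == 1 then k else - k).
  split; [by move=> k; case: eqP => // _; rewrite opprK|by move=> k; case: eqP => // _; rewrite opprK|move=> k].
  rewrite [T]mx11_scalar mul_scalar_mx mxE mulr1n.
  have /orP[/eqP ->|/eqP ->] : (T 0 0 == 1) || (T 0 0 == -1).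
  - by have := eqr_norml (T 0 0) 1; rewrite T1 eqxx ler01 andbT => <-.
  - by rewrite eqxx scale1r subrr; exact: mx_bounded0.
  - rewrite scaleN1r ifF; first by rewrite map_mxN subrr; exact: mx_bounded0.
    by apply/eqP; lra.
have [M MP] := shear_pivot n K.
pose N : R := (1 + n.+1)%:R.
pose s1 := N * K * 1.
pose s2 := N * s1 * Num.max 1 M.
pose s3 := s2 + 1 * s2 * s2.
have U := uniformly_nearM (uniformly_nearM (uniformly_nearM (uniformly_nearM
  (uniformly_near_lower n.+1 s2) (uniformly_near_bordered (IH s3)))
  (uniformly_near_upper n.+1 s2)) (uniformly_near_lower n.+1 M))
  (uniformly_near_upper n.+1 1).
have [r rP] := U; exists r => T [TK detT]; apply: rP.
have [u [v [u1 vM piv]]] := MP T TK detT.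
set T' : 'M[R]_(1 + n.+1) := T *m upper_shear u *m lower_shear v in piv.
have T's2 : mx_bounded s2 T'.
  apply: mx_boundedM; first apply: mx_boundedM => //.
    by apply: mx_bounded_block => //; exact: mx_bounded0.
  apply: mx_bounded_block => //.
  - by apply: mx_boundedW (@mx_bounded1 _); rewrite le_max lexx.
  - by apply: mx_bounded0; rewrite le_max ler01.
  - by apply: mx_boundedW vM; rewrite le_max lexx orbT.
  - by apply: mx_boundedW (@mx_bounded1 _); rewrite le_max lexx.
(* the Schur complement of the pivot *)
pose W := drsubmx T' - dlsubmx T' *m ursubmx T'.
have T'E : T' = lower_shear (dlsubmx T') *m bordered W *m upper_shear (ursubmx T').
  rewrite /lower_shear /upper_shear /bordered !mulmx_block.
  rewrite !mulmx1 !mul1mx !mulmx0 !mul0mx !addr0 !add0r.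
  rewrite -[LHS]submxK piv; congr block_mx; rewrite ?mul1mx ?mulmx1 //.
  by rewrite /W addrC subrK.
have detW : `|\det W| = 1.
  have : `|\det T'| = 1.
    by rewrite !det_mulmx det_ublock det_lblock !det1 !mulr1.
  by rewrite T'E !det_mulmx det_ublock det_lblock det_ublock !det1 !mulr1 !mul1r.
exists (lower_shear (dlsubmx T') *m bordered W *m upper_shear (ursubmx T') *m lower_shear (- v)).
exists (upper_shear (- u)); split.
- exists (lower_shear (dlsubmx T') *m bordered W *m upper_shear (ursubmx T')).
  exists (lower_shear (- v)); split => //; last by exists (- v) => //; exact: mx_boundedN.
  exists (lower_shear (dlsubmx T') *m bordered W), (upper_shear (ursubmx T')).
  split => //.
    exists (lower_shear (dlsubmx T')), (bordered W); split => //.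
      by exists (dlsubmx T') => // i j; rewrite 2!mxE.
    exists W => //; split => //; apply: mx_boundedB.
      by move=> i j; rewrite 2!mxE.
    by apply: mx_boundedM => i j; rewrite 2!mxE.
  by exists (ursubmx T') => // i j; rewrite 2!mxE.
- by exists (- u) => //; exact: mx_boundedN.
by rewrite -T'E /T' -!mulmxA (mulmxA (lower_shear v)) shear_inv_lower mul1mx
  shear_inv_upper mulmx1.
Qed.

End near_lattice_bijections.

(** * Translation invariance of the Lebesgue measure *)

Section lebesgue_measure_facts.
Variable R : realType.
Local Notation RT := (measurableTypeR R).

Let measurable_translation (a : R) : measurable_fun setT (fun x : RT => (x + a : RT)).
Proof.
by apply: (@measurable_funD _ _ R setT id (cst a)); [exact: measurable_id|exact: measurable_cst].
Qed.

(** The Lebesgue measure on the line is determined by its values on the half-open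
intervals, which are invariant. *)
Lemma lebesgue_measure_translation (a : R) (X : set RT) : measurable X ->
  lebesgue_measure ((fun x : RT => (x + a : RT)) @^-1` X) = lebesgue_measure X.
Proof.
move=> mX; rewrite [RHS](lebesgue_measure_unique (mu := image_measure (@lebesgue_measure R) (measurable_translation a))) //.
move=> _ [[x y] _ <-]; rewrite /image_measure /= /pushforward.
have -> : (fun z : RT => (z + a : RT)) @^-1` `]x, y] = `]x - a, y - a]%classic.
  by apply/seteqP; split => z /=; rewrite !in_itv /= ltrBlDr lerBrDr.
rewrite !lebesgue_measure_itv /= !lte_fin ltrD2r.
by case: ifP => // _; rewrite -!EFinB; congr (_%:E); ring.
Qed.

Definition tuple_shift (n : nat) (v : 'I_n -> R) (t : n.-tuple RT) : n.-tuple RT :=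
  [tuple (tnth t i + v i : RT) | i < n].

Let measurable_tuple_shift (n : nat) (v : 'I_n -> R) : measurable_fun setT (tuple_shift v).
Proof.
apply/measurable_fun_tnthP => i.
rewrite (_ : _ \o _ = (fun x : RT => (x + v i : RT)) \o (@tnth _ RT ^~ i)).
  by apply: measurableT_comp => //; exact: measurable_tnth.
by apply/funext => t; rewrite /= tnth_mktuple.
Qed.

(** Induction on the dimension: a translation acts on each factor of the product, and
a measure that agrees with the product measure on rectangles equals it. *)
Lemma lebesgue_tuple_translation (n : nat) (v : 'I_n -> R) (X : set (n.-tuple RT)) :
  measurable X ->
  lebesgue_tuple R n (tuple_shift v @^-1` X) = lebesgue_tuple R n X.
Proof.
elim: n v X => [|n IH] v X mX.
  have -> : tuple_shift v = id; last by rewrite preimage_id.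
  by apply/funext => t; rewrite [LHS]tuple0 [RHS]tuple0.
pose phi (z : RT * n.-tuple RT) : RT * n.-tuple RT :=
  ((z.1 + v ord0 : RT), tuple_shift (fun i => v (lift ord0 i)) z.2).
have mphi : measurable_fun setT phi.
  apply/measurable_fun_pairP; split.
    exact: (measurableT_comp (@measurable_translation (v ord0)) measurable_fst).
  exact: (measurableT_comp (@measurable_tuple_shift n _) measurable_snd).
have E : tuple_shift v \o @cons_pair R n = @cons_pair R n \o phi.
  apply/funext => -[x t]; apply: eq_from_tnth => i; rewrite tnth_mktuple.
  case: (unliftP ord0 i) => [j|] ->; last by rewrite !tnth0.
  by rewrite !tnthS tnth_mktuple.
change ((@lebesgue_measure R \x lebesgue_tuple R n)%E
    (@cons_pair R n @^-1` (tuple_shift v @^-1` X)) =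
  (@lebesgue_measure R \x lebesgue_tuple R n)%E (@cons_pair R n @^-1` X)).
rewrite -comp_preimage E comp_preimage.
have mcX : measurable (@cons_pair R n @^-1` X).
  by rewrite -[X in measurable X]setTI; exact: measurable_cons_pair.
rewrite [RHS](product_measure_unique
  (m' := image_measure (@lebesgue_measure R \x lebesgue_tuple R n)%E mphi)) //.
move=> A B mA mB; rewrite /image_measure /= /pushforward.
have -> : phi @^-1` (A `*` B) = ((fun x : RT => (x + v ord0 : RT)) @^-1` A) `*`
    (tuple_shift (fun i => v (lift ord0 i)) @^-1` B) by [].
rewrite product_measure1E.
- by congr (_ * _)%E; [exact: lebesgue_measure_translation|exact: IH].
- rewrite -[X in measurable X]setTI.
  by apply: measurable_translation.
- by rewrite -[X in measurable X]setTI; apply: measurable_tuple_shift.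
Qed.

Lemma lebesgue_tuple_box (n : nat) (a b : R) : a <= b ->
  lebesgue_tuple R n [set t | forall i, a <= (tnth t i : R) <= b] = ((b - a) ^+ n)%:E.
Proof.
move=> ab; elim: n => [|n IH].
  by rewrite expr0 /= diracE mem_set//= => -[].
change ((@lebesgue_measure R \x lebesgue_tuple R n)%E (@cons_pair R n @^-1`
  [set t | forall i, a <= (tnth t i : R) <= b]) = ((b - a) ^+ n.+1)%:E).
have -> : (@cons_pair R n @^-1` [set t | forall i, a <= (tnth t i : R) <= b]) =
    `[a, b]%classic `*` [set t | forall i, a <= (tnth t i : R) <= b].
  apply/seteqP; split => -[x t] /=.
    move=> h; split; first by have := h ord0; rewrite tnth0 in_itv.
    by move=> i; have := h (lift ord0 i); rewrite tnthS.
  move=> [xab tab] i; case: (unliftP ord0 i) => [j|] ->; last by rewrite tnth0; rewrite in_itv /= in xab.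
  by rewrite tnthS.
rewrite product_measure1E; [|exact: measurable_itv|].
  rewrite exprS EFinM; apply: (congr2 mule _ IH).
  transitivity (@lebesgue_measure R [set` `[a, b]]); first by [].
  rewrite lebesgue_measure_itv /= lte_fin.
  case: ltrP => [_|ba]; first by rewrite -EFinB.
  by congr (_%:E); lra.
rewrite (_ : [set t | _] = \bigcap_(i in [set: 'I_n])
   ((fun t : n.-tuple RT => tnth t i : RT) @^-1` `[a, b])); last first.
  apply/seteqP; split=> [t h i _|t h i] /=; first by rewrite in_itv /=; exact: h.
  by have := h i I; rewrite /= in_itv.
apply: fin_bigcap_measurable => // i _.
by rewrite -[X in measurable X]setTI; apply: measurable_tnth => //; exact: measurable_itv.
Qed.

Lemma continuous_borel_cV (m n : nat) (f : 'cV[R]_m -> 'cV[R]_n) :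
  continuous f -> measurable_fun setT (f : borel_cV R m -> borel_cV R n).
Proof.
move=> /continuousP cf; apply: (@measurability _ _ _ (borel_cV R n) _ _ (@open 'cV[R]_n)) => //.
by move=> _ [U oU <-]; rewrite setTI; apply: sub_sigma_algebra; exact: cf.
Qed.

Lemma measurable_mx_row (m n : nat) (M : 'M[R]_(m, n)) (i : 'I_m) :
  measurable_fun setT ((fun x => (M *m x) i 0) : borel_cV R n -> RT).
Proof.
apply: (eq_measurable_fun (fun x : borel_cV R n => \sum_j (M i j * x j 0 : RT))).
  by move=> x _; rewrite mxE.
apply: measurable_sum => j; apply: measurable_funM; first exact: measurable_cst.
apply: (measurability _ (RGenOpens.measurableE R)).
move=> _ [_ [a [b ->]] <-]; rewrite setTI; apply: sub_sigma_algebra.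
by have /continuousP := @coord_continuous R n 1 j 0; apply; exact: interval_open.
Qed.

Local Notation mu n := (lebesgue_cV R n).

Lemma lebesgue_cV_translation (n : nat) (v : 'cV[R]_n) (X : set (borel_cV R n)) :
  measurable X -> mu n [set x | X (x + v)] = mu n X.
Proof.
move=> mX; rewrite /lebesgue_cV /image_measure /= /pushforward.
rewrite -[RHS](@lebesgue_tuple_translation n (fun i => v i 0)); last first.
  by rewrite -[X in measurable X]setTI; exact: (measurable_cV_of_tuple measurableT mX).
congr (lebesgue_tuple R n _); apply/seteqP; split => t /=;
  rewrite (_ : cV_of_tuple t + v = cV_of_tuple (tuple_shift (fun i => v i 0) t)) //;
  by apply/matrixP => i j; rewrite !mxE tnth_mktuple ord1.
Qed.

Lemma lebesgue_cV_box (n : nat) (a b : R) : a <= b ->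
  mu n [set x | forall i, a <= x i 0 <= b] = ((b - a) ^+ n)%:E.
Proof.
move=> ab; rewrite -lebesgue_tuple_box// /lebesgue_cV /image_measure /= /pushforward.
congr (lebesgue_tuple R n _); apply/seteqP; split => t /= h i; have := h i;
  by rewrite mxE.
Qed.

End lebesgue_measure_facts.

(** * Homogeneous quasi-norms and uniform bounds on A^-j B^j *)

Section quasi_norms.
Variables (R : realType) (n : nat).
Local Notation mu := (lebesgue_cV R n.+1).
Implicit Types (A B : 'M[R]_n.+1) (rho : 'cV[R]_n.+1 -> R).

Lemma mx_boundedX A (a : R) (m : nat) : 1 <= a -> mx_bounded a A ->
  mx_bounded ((n.+1%:R * a) ^+ m) (A ^+ m).
Proof.
move=> a1 Aa; have a0 : 0 <= a by rewrite (le_trans _ a1).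
elim: m => [|m IH].
  move=> i j; rewrite !expr0 mxE; case: eqP => _; rewrite ?normr1 ?normr0//.
by rewrite !exprS; exact: mx_boundedM.
Qed.

Lemma det_exprz A (j : int) : \det (A ^ j) = (\det A) ^ j.
Proof.
have detX m : \det (A ^+ m) = (\det A) ^+ m.
  by elim: m => [|m IH]; rewrite ?expr0 ?det1// !exprS det_mulmx IH.
case: j => m; first exact: detX.
by rewrite -[LHS]/(\det (invmx (A ^+ m.+1))) det_inv detX.
Qed.

(** Otherwise |det A^-k| >= 1 for all k, although the entries of A^-k tend to 0. *)
Lemma expansive_det_gt1 A : A \in unitmx -> expansive A -> 1 < `|\det A|.
Proof.
move=> Au expA; rewrite ltNge; apply/negP => le1.
(* with entries at most e <= 1, the determinant is at most (n+1)! e < 1 *)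
pose e : R := (n.+1`!%:R + 1)^-1.
have e0 : 0 < e by rewrite invr_gt0 ltr_wpDl.
have e1 : e <= 1 by rewrite invf_le1 ?lerDr// ltr_wpDl.
have [L _ /(_ L (leqnn L)) /det_bounded] := expansive_pow_small Au expA e0.
rewrite exprnN det_exprz -exprnN normfV normrX => h.
have d0 : 0 < `|\det A| by rewrite normr_gt0 -unitfE.
have : 1 <= (`|\det A| ^+ L)^-1 by rewrite invf_ge1 ?exprn_gt0// exprn_ile1.
move=> /le_trans /(_ h); apply/negP; rewrite -ltNge.
have : n.+1`!%:R * e ^+ n.+1 <= n.+1`!%:R * e.
  rewrite ler_wpM2l// exprS ler_piMr//; first exact: ltW.
  by apply: exprn_ile1 => //; exact: ltW.
move=> /le_lt_trans; apply; rewrite /e ltr_pdivrMr ?ltr_wpDl// mul1r.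
by rewrite ltrDl.
Qed.

Section one_quasi_norm.
Variables (A : 'M[R]_n.+1) (rho : 'cV[R]_n.+1 -> R).
Hypotheses (Au : A \in unitmx) (Arho : homogeneous_quasi_norm A rho).

Let detA_neq0 : `|\det A| != 0.
Proof. by rewrite normr_eq0 -unitfE. Qed.

Lemma hqn_pow (j : int) (x : 'cV[R]_n.+1) :
  rho (A ^ j *m x) = `|\det A| ^ j * rho x.
Proof.
have pow (m : nat) y : rho (A ^+ m *m y) = `|\det A| ^+ m * rho y.
  elim: m y => [|m IH] y; first by rewrite !expr0 mul1mx mul1r.
  by rewrite !exprS -mulmxA (hqn_homogeneous Arho) IH mulrA.
case: j => m; first exact: pow.
rewrite NegzE -!exprnN; apply: (mulfI (expf_neq0 m.+1 detA_neq0)).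
rewrite -pow mulmxA mulmxV ?mul1mx ?mulVKf ?expf_neq0//.
by rewrite -[_ \in unitmx]/(_ \is a GRing.unit) unitrX.
Qed.

(** A Steinhaus argument. The symmetric sets S_N = {rho x <= N, rho (-x) <= N}
increase to the whole space, so some S_N fills the box [-2, 2]^d up to a set of
measure less than 1/2. For x in [-1, 1]^d the sets S_N and S_N + x then intersect
inside [-1, 1]^d, that is, x is a difference of two points of S_N, and the
quasi-triangle inequality bounds rho x. *)
Lemma hqn_locally_bounded :
  exists2 M, 0 < M & forall x, mx_bounded 1 x -> rho x <= M.
Proof.
have [c c0 tri] := hqn_quasi_triangle Arho.
have mrho := hqn_measurable Arho.
pose box r : set (borel_cV R n.+1) := [set x | forall i, - r <= x i 0 <= r].
have mbox r : measurable (box r).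
  rewrite (_ : box r = \bigcap_(i in [set: 'I_n.+1])
      ((fun x : borel_cV R n.+1 => (1%:M *m x) i 0 : measurableTypeR R) @^-1` `[- r, r])).
    apply: fin_bigcap_measurable => // i _.
    by rewrite -[X in measurable X]setTI; apply: measurable_mx_row.
  apply/seteqP; split=> [x h i _|x h i] /=; first by rewrite mul1mx in_itv /=; exact: h.
  by have := h i I; rewrite /= mul1mx in_itv.
have mN : measurable_fun setT (-%R : borel_cV R n.+1 -> borel_cV R n.+1).
  by apply: continuous_borel_cV; exact: opp_continuous.
pose S (N : nat) : set (borel_cV R n.+1) := [set x | rho x <= N%:R /\ rho (- x) <= N%:R].
have mS N : measurable (S N).
  rewrite (_ : S N = rho @^-1` `]-oo, N%:R] `&` (rho \o -%R) @^-1` `]-oo, N%:R]).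
    apply: measurableI; rewrite -[X in measurable X]setTI.
      by apply: mrho => //; exact: measurable_itv.
    by apply: (measurableT_comp mrho mN) => //; exact: measurable_itv.
  by apply/seteqP; split => x; rewrite /S /= !in_itv.
pose D N := box 2 `\` S N.
have mD N : measurable (D N) by exact: measurableD.
have Dcvg : mu \o D @ \oo --> mu (\bigcap_N D N).
  apply: nonincreasing_cvg_mu => //.
  - rewrite (@le_lt_trans _ _ (mu (box 2)))//; last first.
      by rewrite lebesgue_cV_box ?ltry//; lra.
    by apply: le_measure; rewrite ?inE//; exact: subDsetl.
  - exact: bigcap_measurable.
  - move=> N M NM; apply/subsetPset => x [xb xM]; split => // -[x1 x2]; apply: xM.
    by split; [apply: le_trans x1 _|apply: le_trans x2 _]; rewrite ler_nat.
have D0 : \bigcap_N D N = set0.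
  rewrite -subset0 => x xD; have [_] := xD (Num.truncn (rho x + rho (- x))).+1 I.
  apply; split; apply: (le_trans _ (ltW (truncnS_gt _))).
    by rewrite lerDl (hqn_ge0 Arho).
  by rewrite lerDr (hqn_ge0 Arho).
rewrite D0 measure0 in Dcvg.
have [N DN] : exists N, (mu (D N) < (2^-1)%:E)%E.
  have : nbhs (0 : \bar R) [set y | (y < (2^-1)%:E)%E].
    by apply: open_nbhs_nbhs; split; [exact: open_ereal_lt_ereal|rewrite /= lte_fin].
  by move=> /Dcvg [N _ /(_ N (leqnn N))]; exists N.
exists (c * (N.+1%:R + N.+1%:R)).
  by rewrite mulr_gt0// addr_gt0.
move=> x x1.
have [y [yS yxS]] : exists y, S N y /\ S N (y - x).
  apply: contrapT => noy.
  pose E : set (borel_cV R n.+1) := [set y | D N ((y : 'cV[R]_n.+1) - x)].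
  have muE : mu E = mu (D N) by exact: lebesgue_cV_translation.
  have mE : measurable E.
    have cB : continuous (fun y : 'cV[R]_n.+1 => y - x).
      by move=> y; apply: (@continuousB _ _ _ id (cst x));
        [move=> P|exact: cst_continuous].
    by have := continuous_borel_cV cB measurableT (mD N); rewrite setTI.
  have sub : box 1 `<=` D N `|` E.
    move=> y y1; have [yS|yS] := pselect (S N y); [right; split|left; split => //].
    - move=> i; rewrite !mxE; have := y1 i; have := x1 i 0; rewrite ler_norml; lra.
    - by move=> yx; apply: noy; exists y.
    - move=> i; have := y1 i; lra.
  have : (mu (box 1%R) <= mu (D N) + mu E)%E.
    apply: le_trans (measureU2 _ (mD N) mE).
    by apply: le_measure; rewrite ?inE//; exact: measurableU.
  rewrite muE lebesgue_cV_box; last by lra.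
  apply/negP; rewrite -ltNge.
  apply: (@lt_le_trans _ _ ((2^-1)%:E + (2^-1)%:E)%E); first exact: lteD.
  rewrite -EFinD lee_fin -[2^-1]div1r -splitr.
  by apply: exprn_ege1; rewrite opprK ler_wpDl.
rewrite (_ : x = y + - (y - x)); last by rewrite opprB addrCA subrr addr0.
apply: (le_trans (tri _ _)); rewrite ler_pM2l// lerD//.
  by apply: le_trans (yS.1) _; rewrite ler_nat.
by apply: le_trans (yxS.2) _; rewrite ler_nat.
Qed.

Hypothesis expA : expansive A.

Let detA_gt1 : 1 < `|\det A|. Proof. exact: expansive_det_gt1. Qed.

Lemma det_pow_unbounded (M : R) : exists m : nat, M <= `|\det A| ^+ m.
Proof.
have b0 : 0 < `|\det A| by rewrite (lt_trans _ detA_gt1).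
have e0 : 0 < (`|M| + 1)^-1 by rewrite invr_gt0 ltr_wpDl.
have [|m _ /(_ m (leqnn m))] := @decays_small _ (fun k => `|\det A|^-1 ^+ k) _ _ e0.
  exists 1, (`|\det A|^-1); split => //; last by move=> k; rewrite mul1r.
  by rewrite invr_gt0 b0 invf_lt1.
rewrite exprVn lef_pV2 ?posrE ?exprn_gt0 ?ltr_wpDl// => h; exists m.
by apply: le_trans h; rewrite (le_trans (ler_norm M))// lerDl.
Qed.

(** If A^m x stays in the unit box, rho x = |det A|^-m rho (A^m x) is small. *)
Lemma hqn_continuous0 (e : R) : 0 < e ->
  exists2 d, 0 < d & forall x, mx_bounded d x -> rho x <= e.
Proof.
move=> e0; have [M M0 rhoM] := hqn_locally_bounded.
have [m mP] := det_pow_unbounded (M / e).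
have [a a0 Aa] := mx_bounded_exists (A ^+ m).
exists (n.+1%:R * (a + 1))^-1; first by rewrite invr_gt0 mulr_gt0// ltr_wpDl.
move=> x xd; have := hqn_pow m x; rewrite -!exprnP => E.
have Am0 : 0 < `|\det A| ^+ m by rewrite exprn_gt0// (lt_trans _ detA_gt1).
rewrite -(ler_pM2l Am0) -E; apply: (@le_trans _ _ M); last first.
  by rewrite -ler_pdivrMr.
apply: rhoM.
have Aa1 : mx_bounded (a + 1) (A ^+ m) by apply: mx_boundedW Aa; rewrite lerDl.
apply: mx_boundedW (mx_boundedM Aa1 xd).
by rewrite divff// gt_eqF// mulr_gt0// ltr_wpDl.
Qed.

(** Near a point v with rho v > 0, continuity at 0 and the quasi-triangle inequality
give rho >= rho v / (2 c); compactness of the box makes the bound uniform. Points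
close to 0 are covered as well, vacuously, so that the annulus itself need not be
shown to be closed. *)
Lemma hqn_annulus_lower_bound (k : R) : 0 < k ->
  exists2 d, 0 < d & forall x, mx_bounded 1 x -> (exists i, k <= `|x i 0|) -> d <= rho x.
Proof.
move=> k0; have [c c0 tri] := hqn_quasi_triangle Arho.
have cpt : compact [set v : 'rV[R]_n.+1 | forall i, [set` `[(-1 : R), 1]] (v ord0 i)].
  by apply: (@rV_compact R n.+1 (fun=> [set` `[(-1 : R), 1]])) => i; exact: segment_compact.
have /compact_near_coveringP/(_ R ((0:R)^'+)
  (fun d v => (exists i, k <= `|v 0 i|) -> d <= rho v^T)) := cpt.
have cov : forall v : 'rV[R]_n.+1, (forall i, [set` `[(-1 : R), 1]] (v ord0 i)) ->
    filter_prod (nbhs v) ((0 : R)^'+)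
      [set w : 'rV[R]_n.+1 * R | (exists i, k <= `|w.1 0 i|) -> w.2 <= rho w.1^T].
  move=> v v1.
  have [v0|v0] := eqVneq v 0.
    exists (ball v k, setT); first by split; [exact: nbhsx_ballx|exact: filterT].
    move=> [v' d] [/= [_ vv'] _] [l]; rewrite leNgt => /negP[].
    have := vv' 0 l; rewrite v0 /ball /= mxE sub0r normrN; exact.
  have vt0 : 0 < rho v^T by apply: (hqn_gt0 Arho); rewrite trmx_eq0.
  have e0 : 0 < rho v^T / (2 * c) by rewrite divr_gt0// mulr_gt0.
  have [t t0 tP] := hqn_continuous0 e0.
  exists (ball v t, [set d | d < rho v^T / (2 * c)]).
    by split; [exact: nbhsx_ballx|exact: nbhs_right_lt].
  move=> [v' d] [/= [_ vv'] dlt] _.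
  have : rho (v - v')^T <= rho v^T / (2 * c).
    by apply: tP => i j; rewrite !mxE ord1 ltW//; exact: vv'.
  have := tri (v - v')^T v'^T; rewrite -linearD subrK /= => h1 h2.
  apply: ltW; apply: (lt_le_trans dlt); rewrite ler_pdivrMr ?mulr_gt0//.
  have : c * rho (v - v')^T <= rho v^T / 2.
    by rewrite mulrC -ler_pdivlMr// -mulrA -invfM.
  lra.
have FF : Filter ((0 : R)^'+) by exact: within_filter.
move=> /(_ FF cov) near_d.
have both := @filterI _ _ FF _ _ near_d (nbhs_right_gt (0 : R)).
have [d [dP d0]] := @filter_ex _ _ (at_right_proper_filter (0 : R)) _ both.
exists d; first exact: d0.
move=> x x1 [l lx]; rewrite -[x]trmxK.
have xK : forall i, [set` `[(-1 : R), 1]] (x^T ord0 i).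
  by move=> j; rewrite /= mxE in_itv /= -ler_norml.
by apply: (dP x^T xK); exists l; rewrite mxE.
Qed.

(** The first m with A^-m x in the unit box puts A^-m x in an annulus, where rho is
bounded below by some d. Then d |det A|^m <= rho x <= M bounds m, hence x. *)
Lemma hqn_sublevel_bounded (M : R) :
  exists r, forall x, rho x <= M -> mx_bounded r x.
Proof.
have [a0 a00 Aa0] := mx_bounded_exists A.
pose a := Num.max 1 a0.
have Aa : mx_bounded a A by apply: mx_boundedW Aa0; rewrite le_max lexx orbT.
have a1 : 1 <= a by rewrite le_max lexx.
(* if A x leaves the unit box, some entry of x is at least k *)
pose k := (n.+1%:R * a)^-1.
have na1 : 1 <= n.+1%:R * a by rewrite mulr_ege1// ler1n.
have k0 : 0 < k by rewrite invr_gt0 (lt_le_trans _ na1).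
have [d d0 dP] := hqn_annulus_lower_bound k0.
have [m0 m0P] := det_pow_unbounded (M / d + 1).
exists (Num.max 1 (n.+1%:R * (n.+1%:R * a) ^+ m0 * 1)) => x xM.
have [x1|x1] := pselect (mx_bounded 1 x); first by apply: mx_boundedW x1; rewrite le_max lexx.
have ex : exists m, `[< mx_bounded 1 (A ^- m *m x) >].
  have [b b0 xb] := mx_bounded_exists x.
  have e0 : 0 < (n.+1%:R * (b + 1))^-1 by rewrite invr_gt0 mulr_gt0// ltr_wpDl.
  have [L _ /(_ L (leqnn L)) AL] := expansive_pow_small Au expA e0.
  have xb1 : mx_bounded (b + 1) x by apply: mx_boundedW xb; rewrite lerDl.
  exists L; apply/asboolP; apply: mx_boundedW (mx_boundedM AL xb1).
  by rewrite invfM mulVKf// mulVf// gt_eqF// ltr_wpDl.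
case: (ex_minnP ex) => -[|m] /asboolP mP mmin.
  by case: x1; move: mP; rewrite expr0 invr1 mul1mx.
have mprev : ~ mx_bounded 1 (A ^- m *m x).
  by move=> /asboolP /mmin; rewrite ltnn.
have big : exists i, k <= `|(A ^- m.+1 *m x) i 0|.
  apply: contrapT => nobig; apply: mprev.
  have -> : A ^- m *m x = A *m (A ^- m.+1 *m x).
    by rewrite mulmxA -[A *m _]/(A * _) exprSr invrM ?unitrX// mulVKr.
  apply: (@mx_boundedW _ _ _ (n.+1%:R * a * k)); first by rewrite divff// gt_eqF// (lt_le_trans _ na1).
  apply: mx_boundedM => // i j; rewrite ord1 leNgt; apply/negP => /ltW h.
  by apply: nobig; exists i.
have := dP _ mP big; rewrite exprnN hqn_pow -exprnN => dle.
have b0 : 0 < `|\det A| ^+ m.+1 by rewrite exprn_gt0// (lt_trans _ detA_gt1).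
have bm : `|\det A| ^+ m.+1 <= M / d.
  rewrite ler_pdivlMr//; apply: le_trans xM.
  by rewrite mulrC -ler_pdivlMr// mulrC.
have mm0 : (m.+1 <= m0)%N.
  rewrite leqNgt; apply/negP => m0m.
  have : `|\det A| ^+ m0 <= `|\det A| ^+ m.+1 by apply: ler_weXn2l; [exact: ltW|exact: ltnW].
  by lra.
have -> : x = A ^+ m.+1 *m (A ^- m.+1 *m x).
  rewrite mulmxA mulmxV ?mul1mx//.
  by rewrite -[_ \in unitmx]/(_ \is a GRing.unit) unitrX.
apply: mx_boundedW (mx_boundedM (mx_boundedX m.+1 a1 Aa) mP).
rewrite le_max; apply/orP; right; rewrite !mulr1 ler_wpM2l//.
by rewrite ler_weXn2l.
Qed.

End one_quasi_norm.

(** It suffices to bound A^-j B^j on the basis vectors e, and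
rhoA (A^-j B^j e) <= C |det A|^-j rhoB (B^j e) = C rhoB e. *)
Lemma hqn_dominated_bounded A B rhoA rhoB (C : R) :
  A \in unitmx -> B \in unitmx -> expansive A ->
  homogeneous_quasi_norm A rhoA -> homogeneous_quasi_norm B rhoB ->
  0 <= C -> (forall x, rhoA x <= C * rhoB x) -> `|\det A| = `|\det B| ->
  exists K, forall j : int, mx_bounded K (A ^ (- j) *m B ^ j).
Proof.
move=> Au Bu expA Arho Brho C0 AB detAB.
pose M := \sum_(i < n.+1) C * rhoB (delta_mx i 0).
have [r rP] := hqn_sublevel_bounded Au Arho expA M.
exists r => j i k.
have -> : (A ^ (- j) *m B ^ j) i k = (A ^ (- j) *m (B ^ j *m (delta_mx k 0 : 'cV_n.+1))) i 0.
  by rewrite mulmxA -colE [RHS]mxE.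
apply: rP; rewrite (hqn_pow Au Arho).
have dj : 0 < `|\det A| ^ j.
  by rewrite exprz_gt0// normr_gt0 -unitfE.
apply: (@le_trans _ _ (C * rhoB (delta_mx k 0))); last first.
  rewrite /M (bigD1 k)//= lerDl; apply: sumr_ge0 => l _.
  by rewrite mulr_ge0// (hqn_ge0 Brho).
rewrite -invr_expz mulrC ler_pdivrMr// (le_trans (AB _))//.
by rewrite (hqn_pow Bu Brho) -detAB mulrAC mulrA.
Qed.

Lemma equivalent_matrices_bounded A B :
  A \in unitmx -> B \in unitmx -> expansive A -> expansive B ->
  equivalent_matrices A B -> `|\det A| = `|\det B| ->
  exists K, forall j : int,
    mx_bounded K (A ^ (- j) *m B ^ j) /\ mx_bounded K (B ^ (- j) *m A ^ j).
Proof.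
move=> Au Bu expA expB [rhoA [rhoB [Arho Brho [C C1 CP]]]] detAB.
have C0 : 0 < C by rewrite (lt_le_trans _ C1).
have [|K KP] := hqn_dominated_bounded Au Bu expA Arho Brho (ltW C0) _ detAB.
  by move=> x; have /andP[h _] := CP x; rewrite -ler_pdivrMl.
have [|L LP] := hqn_dominated_bounded Bu Au expB Brho Arho (ltW C0) _ (esym detAB).
  by move=> x; have /andP[_ h] := CP x.
exists (Num.max K L) => j; split.
  by apply: mx_boundedW (KP j); rewrite le_max lexx.
by apply: mx_boundedW (LP j); rewrite le_max lexx orbT.
Qed.

End quasi_norms.

(** * Integrals of powers of laminar sums *)

Section power_inequalities.
Variable R : realType.
Implicit Types s t v a f g : R.

(** Convexity of the inverse function, the power 1/t, applied to the powers x^t, y^t. *)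
Lemma concave_powR t (l x y : R) : 0 < t <= 1 -> 0 <= l <= 1 -> 0 <= x -> 0 <= y ->
  l * x `^ t + (1 - l) * y `^ t <= (l * x + (1 - l) * y) `^ t.
Proof.
move=> /andP[t0 t1] /andP[l0 l1] x0 y0.
have L01 : Itv.spec (@Itv.num_sem R) (Itv.Real `[0%Z, 1%Z]) l.
  by rewrite /Itv.num_sem /= num_real in_itv /= l0 l1.
have ti1 : 1 <= t^-1 by rewrite invf_ge1.
have h : (l * x `^ t + (1 - l) * y `^ t) `^ t^-1 <=
    l * (x `^ t) `^ t^-1 + (1 - l) * (y `^ t) `^ t^-1.
  by apply: (@convex_powR R t^-1 ti1 (Itv.mk L01) (x `^ t) (y `^ t));
    rewrite inE /= in_itv /= powR_ge0.
have s0 : 0 <= l * x `^ t + (1 - l) * y `^ t.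
  by rewrite addr_ge0// mulr_ge0// ?powR_ge0// subr_ge0.
rewrite -!powRrM divff ?gt_eqF// !powRr1// in h.
rewrite -[leLHS]powRr1// -[X in _ `^ X <= _](mulVf (lt0r_neq0 t0)) powRrM.
have w0 : 0 <= l * x + (1 - l) * y.
  by apply: addr_ge0; apply: mulr_ge0 => //; rewrite subr_ge0.
by apply: ge0_ler_powR; rewrite ?nnegrE ?powR_ge0 ?(ltW t0).
Qed.

(** Concavity: the points s + a and v lie between s and v + a, and have the same sum
as these two. *)
Lemma powR_increment_antitone t (s v a : R) : 0 < t <= 1 -> 0 <= s <= v -> 0 <= a ->
  (v + a) `^ t + s `^ t <= (s + a) `^ t + v `^ t.
Proof.
move=> t01 /andP[s0 sv] a0.
have [L0|L0] := leP (v + a - s) 0.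
  have -> : a = 0 by lra.
  by rewrite !addr0 addrC.
have lL : 0 <= (v - s) / (v + a - s) <= 1.
  apply/andP; split; last by rewrite ler_pdivrMr//; lra.
  by apply: divr_ge0; [rewrite subr_ge0|exact: ltW].
have lL' : 0 <= a / (v + a - s) <= 1.
  apply/andP; split; last by rewrite ler_pdivrMr//; lra.
  by rewrite divr_ge0// ltW.
have va0 : 0 <= v + a by lra.
have h1 := concave_powR t01 lL va0 s0.
have h2 := concave_powR t01 lL' va0 s0.
have E1 : (v - s) / (v + a - s) * (v + a) + (1 - (v - s) / (v + a - s)) * s = v.
  by field; rewrite gt_eqF.
have E2 : a / (v + a - s) * (v + a) + (1 - a / (v + a - s)) * s = s + a.
  by field; rewrite gt_eqF.
rewrite E1 in h1; rewrite E2 in h2; have := lerD h2 h1; apply: le_trans.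
rewrite le_eqVlt; apply/orP; left; apply/eqP; field; by rewrite gt_eqF.
Qed.

Lemma bernoulli_le (r : R) (N : nat) : 0 <= r <= 1 -> 1 - N%:R * (1 - r) <= r ^+ N.
Proof.
move=> /andP[r0 r1]; elim: N => [|N IH]; first by rewrite mul0r subr0 expr0.
apply: (@le_trans _ _ (r * (1 - N%:R * (1 - r)))); last by rewrite exprS ler_wpM2l.
have : 0 <= N%:R * (1 - r) * (1 - r) by rewrite !mulr_ge0 ?subr_ge0.
by rewrite -natr1; nra.
Qed.

(** With r = v / (v + a), this is Bernoulli's inequality for r^N together with
r^N <= r^t. *)
Lemma powR_increment_le t (N : nat) (v a : R) : 1 <= t -> t <= N%:R -> 0 <= v -> 0 <= a ->
  (v + a) `^ t <= v `^ t + N%:R * a * (v + a) `^ (t - 1).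
Proof.
move=> t1 tN v0 a0; have t0 : 0 < t by rewrite (lt_le_trans _ t1).
have : 0 <= v + a by rewrite addr_ge0.
rewrite le_eqVlt => /predU1P[<-|w0].
  by rewrite powR0 ?gt_eqF// addr_ge0 ?powR_ge0// !mulr_ge0 ?powR_ge0.
set w := v + a in w0 *; pose r := v / w.
have r01 : 0 <= r <= 1 by rewrite divr_ge0 ?(ltW w0)//= ler_pdivrMr// mul1r lerDl.
have rt : 1 - N%:R * (1 - r) <= r `^ t.
  have [r0|r0] := eqVneq r 0.
    rewrite (le_trans _ (powR_ge0 _ _))// r0 subr0 mulr1 subr_le0.
    exact: le_trans tN.
  apply: (le_trans (bernoulli_le N r01)); rewrite -powR_mulrn; last by case/andP: r01.
  by apply: ger_powR => //; rewrite lt0r r0.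
have -> : v `^ t = w `^ t * r `^ t.
  rewrite -powRM; [|exact: ltW|by case/andP: r01].
  by rewrite /r mulrC divfK// gt_eqF.
have -> : N%:R * a * w `^ (t - 1) = w `^ t * (N%:R * (1 - r)).
  rewrite powRB; last by apply/implyP => _; rewrite gt_eqF.
  rewrite powRr1 ?(ltW w0)// /r /w; field.
  by rewrite gt_eqF.
by rewrite -mulrDr ler_peMr ?powR_ge0// -lerBlDr.
Qed.

(** Either f <= e g, and the first term dominates, or g < f / e, and the second does. *)
Lemma powR_young t e f g : 1 <= t -> 0 < e -> 0 <= f -> 0 <= g ->
  f * g `^ (t - 1) <= e * g `^ t + e^-1 `^ (t - 1) * f `^ t.
Proof.
move=> t1 e0 f0 g0; have t0 : 0 < t by rewrite (lt_le_trans _ t1).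
have split_pow (h : R) : 0 <= h -> h `^ t = h * h `^ (t - 1).
  rewrite le_eqVlt => /predU1P[<-|h0]; first by rewrite mul0r powR0// gt_eqF.
  rewrite powRB; last by apply/implyP => _; rewrite gt_eqF.
  by rewrite powRr1 ?(ltW h0)// mulrCA divff ?mulr1// gt_eqF.
have [fg|gf] := leP f (e * g).
  apply: (@le_trans _ _ (e * g `^ t)); last by rewrite lerDl mulr_ge0 ?powR_ge0.
  by rewrite (split_pow g)// mulrA ler_wpM2r// powR_ge0.
apply: (@le_trans _ _ (e^-1 `^ (t - 1) * f `^ t)).
  rewrite (split_pow f)// mulrCA ler_wpM2l// -powRM//; last by rewrite invr_ge0 ltW.
  apply: ge0_ler_powR; rewrite ?nnegrE ?subr_ge0//.
    by rewrite mulr_ge0// invr_ge0 ltW.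
  by rewrite ler_pdivlMl// ltW.
by rewrite lerDr mulr_ge0 ?powR_ge0// ltW.
Qed.

Lemma powR_sum_le t (I : Type) (r : seq I) (f : I -> R) : 0 < t -> (forall i, 0 <= f i) ->
  (\sum_(i <- r) f i) `^ t <= ((size r)%:R `^ t) * \sum_(i <- r) f i `^ t.
Proof.
move=> t0 f0.
have [m [m0 fm mf]] : exists m : R, [/\ 0 <= m, \sum_(i <- r) f i <= (size r)%:R * m &
    m `^ t <= \sum_(i <- r) f i `^ t].
  elim: r => [|i r [m [m0 fm mf]]].
    by exists 0; rewrite !big_nil mulr0 powR0 ?gt_eqF.
  exists (Num.max m (f i)); split; first by rewrite le_max m0.
    rewrite big_cons /= -natr1 mulrDl mul1r addrC lerD//.
      by apply: (le_trans fm); rewrite ler_wpM2l// le_max lexx.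
    by rewrite le_max lexx orbT.
  rewrite big_cons; case: (leP m (f i)) => _.
    by rewrite lerDl sumr_ge0// => *; exact: powR_ge0.
  by rewrite (le_trans mf)// lerDr powR_ge0.
apply: (@le_trans _ _ (((size r)%:R * m) `^ t)).
  apply: ge0_ler_powR; rewrite ?nnegrE//; first exact: ltW.
    exact: sumr_ge0.
  by rewrite mulr_ge0.
by rewrite powRM// ler_wpM2l// powR_ge0.
Qed.

End power_inequalities.

(** The constant 1 / (2 c) is chosen so that half of x is absorbed on the left, which
is legitimate because x is finite. *)
Lemma absorb_half (R : realType) (N c K : R) (x y z : \bar R) :
  0 < c -> 0 <= K -> N <= c -> (0 <= y)%E -> (0 <= x)%E -> (x < +oo)%E -> (0 <= z)%E ->
  (x <= N%:E * y)%E -> (y <= (2 * c)^-1%:E * x + K%:E * z)%E ->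
  (x <= (2 * (c * K))%:E * z)%E.
Proof.
move=> c0 K0 Nc y0 x0 xoo z0 xNy.
rewrite mulrA (EFinM (2 * c)) -muleA.
have Kz0 : (0 <= K%:E * z)%E by exact: mule_ge0.
move: (K%:E * z)%E Kz0 => w; case: w => [w| |]// w0; last first.
  by move=> _; rewrite gt0_muley ?leey// lte_fin mulr_gt0.
move: x y x0 xoo y0 xNy => [x| |]// [y| |]// x0 _ y0.
rewrite -!EFinM -EFinD !lee_fin in x0 y0 w0 * => xNy h.
have xcy : x <= c * y by apply: (le_trans xNy); rewrite ler_wpM2r.
have : c * y <= c * ((2 * c)^-1 * x + w) by rewrite ler_wpM2l// ltW.
have -> : c * ((2 * c)^-1 * x + w) = x / 2 + c * w by field; rewrite gt_eqF.
by lra.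
Qed.

(** The constant that [absorb_half] produces from the exponent t and the volume
ratio D, with N the least integer above t. *)
Definition hull_constant_ge1 (R : realType) (t D : R) : R :=
  let c := (Num.truncn t).+1%:R * D + 1 in 2 * (c * (2 * c) `^ (t - 1)).

Section laminar.
Context d (T : measurableType d) (R : realType) (mu : {measure set T -> \bar R}).
Variables (I : Type) (Q U : I -> set T) (a : I -> R).
Implicit Types (s : seq I) (t : R).

Definition weighted_sum (E : I -> set T) s (x : T) : R :=
  \sum_(i <- s) a i * \1_(E i) x.

Hypothesis a0 : forall i, 0 <= a i.

Lemma weighted_sum_ge0 E s x : 0 <= weighted_sum E s x.
Proof. by apply: sumr_ge0 => i _; rewrite mulr_ge0. Qed.

Lemma measurable_weighted_sum E s : (forall i, measurable (E i)) ->
  measurable_fun setT (weighted_sum E s).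
Proof.
move=> mE; apply: measurable_sum => i.
by apply: measurable_funM => //; exact: measurable_indic.
Qed.

Lemma weighted_sum_le E E' s x : (forall i, E i `<=` E' i) ->
  weighted_sum E s x <= weighted_sum E' s x.
Proof.
move=> EE'; apply: ler_sum => i _; rewrite ler_wpM2l// !indicE ler_nat.
by case: (boolP (x \in E i)) => [/set_mem/EE'/mem_set ->|].
Qed.

Lemma weighted_sum_rcons E s i x :
  weighted_sum E (rcons s i) x = weighted_sum E s x + a i * \1_(E i) x.
Proof. by rewrite /weighted_sum big_rcons /= addrC. Qed.

Lemma ge0_integral_le (f g : T -> R) : (forall x, 0 <= f x) ->
  measurable_fun setT f -> measurable_fun setT g -> (forall x, f x <= g x) ->
  (\int[mu]_x (f x)%:E <= \int[mu]_x (g x)%:E)%E.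
Proof.
move=> f0 mf mg fg; apply: ge0_le_integral => //.
- by move=> x _; rewrite lee_fin.
- exact/measurable_EFinP.
- exact/measurable_EFinP.
- by move=> x _; rewrite lee_fin.
Qed.

Lemma ge0_integral_lincomb (f g : T -> R) (b c : R) :
  (forall x, 0 <= f x) -> measurable_fun setT f ->
  (forall x, 0 <= g x) -> measurable_fun setT g -> 0 <= b -> 0 <= c ->
  (\int[mu]_x (b * f x + c * g x)%:E =
   b%:E * \int[mu]_x (f x)%:E + c%:E * \int[mu]_x (g x)%:E)%E.
Proof.
move=> f0 mf g0 mg b0 c0.
rewrite -!ge0_integralZl//; try by [exact/measurable_EFinP|move=> x _; rewrite lee_fin].
rewrite -ge0_integralD//.
- by move=> x _; rewrite -EFinM lee_fin mulr_ge0.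
- by apply: measurable_funeM; exact/measurable_EFinP.
- by move=> x _; rewrite -EFinM lee_fin mulr_ge0.
- by apply: measurable_funeM; exact/measurable_EFinP.
Qed.

Lemma ge0_integral_add_indic (f : T -> R) (c : R) (E : set T) : (forall x, 0 <= f x) ->
  measurable_fun setT f -> 0 <= c -> measurable E ->
  (\int[mu]_x (f x + c * \1_E x)%:E = \int[mu]_x (f x)%:E + c%:E * mu E)%E.
Proof.
move=> f0 mf c0 mE.
have mi : measurable_fun setT (\1_E : T -> R) by exact: measurable_indic.
have := @ge0_integral_lincomb f (\1_E) 1 c f0 mf _ mi ler01 c0.
rewrite integral_indic// setIT mul1e => <- //.
by under [RHS]eq_integral do rewrite mul1r.
Qed.

(** The order of the list matters: a later hull is never strictly larger than an
earlier one that it meets. *)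
Definition laminar s := pairwise (fun i k =>
  `[< U i `&` U k = set0 \/ U k `<=` U i >]) s.

Hypotheses (mQ : forall i, measurable (Q i)) (mU : forall i, measurable (U i)).
Hypothesis QU : forall i, Q i `<=` U i.
Hypothesis Ufin : forall i, (mu (U i) < +oo)%E.
Variable D : R.
Hypothesis D0 : 0 <= D.
Hypothesis UQ : forall i, (mu (U i) <= D%:E * mu (Q i))%E.

Local Notation F := (weighted_sum Q).
Local Notation G := (weighted_sum U).

Let mFt s t : measurable_fun setT (fun x => F s x `^ t).
Proof. by apply: (measurableT_comp (measurable_powR _)) => //; exact: measurable_weighted_sum. Qed.

Let mGt s t : measurable_fun setT (fun x => G s x `^ t).
Proof. by apply: (measurableT_comp (measurable_powR _)) => //; exact: measurable_weighted_sum. Qed.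

(** The last hull lies inside or outside each of the earlier ones. *)
Lemma laminar_constant s i : laminar (rcons s i) ->
  exists2 v : R, 0 <= v & forall x, U i x -> G s x = v.
Proof.
rewrite /laminar pairwise_rcons => /andP[si _].
have Gc x y : U i x -> U i y -> G s x = G s y.
  move=> xU yU; elim: s si => [|k s IH]; first by rewrite /weighted_sum !big_nil.
  rewrite /= => /andP[/asboolP ki /IH sxy]; rewrite /weighted_sum !big_cons.
  congr (_ + _) => //; congr (_ * _); rewrite !indicE.
  case: ki => [disj|sub]; last by rewrite !mem_set//; exact: sub.
  have out z : U i z -> z \in U k = false.
    by move=> zU; apply/negP => /set_mem zk; suff : set0 z by []; rewrite -disj.
  by rewrite !out.
have [[x xU]|noU] := pselect (exists x, U i x).
  by exists (G s x) => [|y yU]; [exact: weighted_sum_ge0|exact: Gc].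
by exists 0 => // x xU; case: noU; exists x.
Qed.

Lemma laminar_increment s i t : 0 < t -> laminar (rcons s i) ->
  exists2 v : R, 0 <= v & (forall x, U i x -> G s x = v) /\
    forall x, G (rcons s i) x `^ t = G s x `^ t + ((v + a i) `^ t - v `^ t) * \1_(U i) x.
Proof.
move=> t0 /laminar_constant[v v0 vG]; exists v => //; split => // x.
rewrite weighted_sum_rcons indicE; case: (boolP (x \in U i)) => [/set_mem xU|_].
  by rewrite !mulr1 (vG x xU) [RHS]addrC subrK.
by rewrite !mulr0 !addr0.
Qed.

Let incr_ge0 (v b t : R) : 0 < t -> 0 <= v -> 0 <= b -> 0 <= (v + b) `^ t - v `^ t.
Proof.
move=> t0 v0 b0; rewrite subr_ge0 ge0_ler_powR ?nnegrE ?addr_ge0 ?lerDl//; exact: ltW.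
Qed.

Lemma laminar_integral_rcons s i t : 0 < t -> laminar (rcons s i) ->
  exists v : R, [/\ 0 <= v, (forall x, U i x -> G s x = v) &
    (\int[mu]_x (G (rcons s i) x `^ t)%:E =
     \int[mu]_x (G s x `^ t)%:E + ((v + a i) `^ t - v `^ t)%:E * mu (U i))%E].
Proof.
move=> t0 /(laminar_increment t0)[v v0 [vG GE]]; exists v; split => //.
under eq_integral do rewrite GE.
by rewrite ge0_integral_add_indic// => [x|]; [exact: powR_ge0|exact: incr_ge0].
Qed.

Let integral_nil E t : 0 < t -> (\int[mu]_x (weighted_sum E [::] x `^ t)%:E = 0)%E.
Proof.
move=> t0; under eq_integral do rewrite /weighted_sum big_nil powR0 ?gt_eqF//.
exact: integral0.
Qed.

Let laminar_belast s i : laminar (rcons s i) -> laminar s.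
Proof. by rewrite /laminar pairwise_rcons => /andP[]. Qed.

Lemma laminar_integral_finite s t : 0 < t -> laminar s ->
  (\int[mu]_x (G s x `^ t)%:E < +oo)%E.
Proof.
move=> t0; elim/last_ind: s => [_|s i IH si]; first by rewrite integral_nil.
have [v [v0 _ ->]] := laminar_integral_rcons t0 si.
apply: lte_add_pinfty; first exact/IH/(laminar_belast si).
by rewrite lte_mul_pinfty ?lee_fin ?incr_ge0.
Qed.

(** Adding the last cube increases the left-hand integral by
((v + a)^t - v^t) |U|, where v is the value of G on U. On Q the value of F is at
most v, so by concavity F^t increases there at least as much as G^t does, and
|U| <= D |Q|. *)
Lemma laminar_integral_le1 s t : 0 < t <= 1 -> laminar s ->
  (\int[mu]_x (G s x `^ t)%:E <= D%:E * \int[mu]_x (F s x `^ t)%:E)%E.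
Proof.
move=> t01; have t0 : 0 < t by case/andP: t01.
elim/last_ind: s => [_|s i IH si]; first by rewrite !integral_nil// mule0.
have [v [v0 vG ->]] := laminar_integral_rcons t0 si.
set b := (v + a i) `^ t - v `^ t; have b0 : 0 <= b by exact: incr_ge0.
apply: (@le_trans _ _ (D%:E * (\int[mu]_x (F s x `^ t)%:E + b%:E * mu (Q i)))%E).
  rewrite ge0_muleDr; last 2 first.
  - by apply: integral_ge0 => x _; rewrite lee_fin powR_ge0.
  - by rewrite mule_ge0.
  apply: leeD; first exact/IH/(laminar_belast si).
  by rewrite muleCA lee_wpmul2l ?lee_fin.
apply: lee_wpmul2l; first by rewrite lee_fin.
rewrite -ge0_integral_add_indic//; last by move=> x; exact: powR_ge0.
apply: ge0_integral_le => //.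
- by move=> x; rewrite addr_ge0 ?powR_ge0// mulr_ge0.
- by apply: measurable_funD => //; apply: measurable_funM => //; exact: measurable_indic.
move=> x; rewrite weighted_sum_rcons indicE.
case: (boolP (x \in Q i)) => [/set_mem xQ|_]; last by rewrite !mulr0 !addr0.
rewrite !mulr1 /b addrA lerBlDr addrC.
apply: powR_increment_antitone => //.
by rewrite weighted_sum_ge0 -(vG x (QU xQ)) weighted_sum_le.
Qed.

(** For t >= 1 the increment (v + a)^t - v^t is at most N a (v + a)^(t-1), and
(v + a)^(t-1) is the value of the new G^(t-1) on Q. *)
Lemma laminar_integral_product s t (N : nat) : 1 <= t -> t <= N%:R -> laminar s ->
  (\int[mu]_x (G s x `^ t)%:E <=
   (N%:R * D)%:E * \int[mu]_x (F s x * G s x `^ (t - 1))%:E)%E.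
Proof.
move=> t1 tN; have t0 : 0 < t by rewrite (lt_le_trans _ t1).
have ND0 : 0 <= N%:R * D by rewrite mulr_ge0.
elim/last_ind: s => [_|s i IH si].
  rewrite integral_nil// mule_ge0 ?lee_fin//; apply: integral_ge0 => x _.
  by rewrite lee_fin mulr_ge0 ?powR_ge0 ?weighted_sum_ge0.
have [v [v0 vG ->]] := laminar_integral_rcons t0 si.
set b := (v + a i) `^ t - v `^ t; have b0 : 0 <= b by exact: incr_ge0.
pose e := a i * (v + a i) `^ (t - 1); have e0 : 0 <= e by rewrite mulr_ge0 ?powR_ge0.
have mFG s' : measurable_fun setT (fun x => F s' x * G s' x `^ (t - 1)).
  by apply: measurable_funM => //; exact: measurable_weighted_sum.
have FG0 s' x : 0 <= F s' x * G s' x `^ (t - 1).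
  by rewrite mulr_ge0 ?powR_ge0 ?weighted_sum_ge0.
apply: (@le_trans _ _ ((N%:R * D)%:E *
    (\int[mu]_x (F s x * G s x `^ (t - 1))%:E + e%:E * mu (Q i)))%E).
  rewrite ge0_muleDr; last 2 first.
  - by apply: integral_ge0 => x _; rewrite lee_fin.
  - by rewrite mule_ge0.
  apply: leeD; first exact/IH/(laminar_belast si).
  apply: (@le_trans _ _ ((N%:R * e)%:E * (D%:E * mu (Q i)))%E); last first.
    by rewrite !muleA -!EFinM lee_wpmul2r// lee_fin mulrAC.
  apply: lee_pmul; rewrite ?lee_fin//.
  by rewrite /b lerBlDl mulrA powR_increment_le.
apply: lee_wpmul2l; first by rewrite lee_fin.
rewrite -ge0_integral_add_indic//.
apply: ge0_integral_le => //.
- by move=> x; rewrite addr_ge0// mulr_ge0.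
- by apply: measurable_funD => //; apply: measurable_funM => //; exact: measurable_indic.
move=> x.
have Gle : G s x `^ (t - 1) <= G (rcons s i) x `^ (t - 1).
  apply: ge0_ler_powR; rewrite ?nnegrE ?subr_ge0 ?weighted_sum_ge0//.
  by rewrite weighted_sum_rcons lerDl mulr_ge0.
rewrite [F (rcons s i) x]weighted_sum_rcons mulrDl lerD//.
  by rewrite ler_wpM2l// weighted_sum_ge0.
rewrite !indicE; case: (boolP (x \in Q i)) => [/set_mem xQ|_]; last by rewrite !mulr0 mul0r.
rewrite !mulr1 weighted_sum_rcons (vG x (QU xQ)) indicE mem_set ?mulr1//.
exact: QU.
Qed.

(** Young's inequality in [laminar_integral_product]; the integral of G^t that appears
on the right is finite and can be absorbed. *)
Lemma laminar_integral_ge1 s t : 1 <= t -> laminar s ->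
  (\int[mu]_x (G s x `^ t)%:E <=
   (hull_constant_ge1 t D)%:E * \int[mu]_x (F s x `^ t)%:E)%E.
Proof.
move=> t1; have t0 : 0 < t by rewrite (lt_le_trans _ t1).
rewrite /hull_constant_ge1; set N := (Num.truncn t).+1.
have tN : t <= N%:R by exact/ltW/truncnS_gt.
set c := N%:R * D + 1; have c0 : 0 < c by rewrite ltr_wpDl// mulr_ge0.
have e0 : 0 < (2 * c)^-1 by rewrite invr_gt0 mulr_gt0.
set K := (2 * c) `^ (t - 1); have K0 : 0 <= K by exact: powR_ge0.
move=> ls; have IGle := laminar_integral_product t1 tN ls.
have IGfin := laminar_integral_finite t0 ls.
have IFG0 : (0 <= \int[mu]_x (F s x * G s x `^ (t - 1))%:E)%E.
  by apply: integral_ge0 => x _; rewrite lee_fin mulr_ge0 ?powR_ge0 ?weighted_sum_ge0.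
have IG0 : (0 <= \int[mu]_x (G s x `^ t)%:E)%E.
  by apply: integral_ge0 => x _; rewrite lee_fin powR_ge0.
have IF0 : (0 <= \int[mu]_x (F s x `^ t)%:E)%E.
  by apply: integral_ge0 => x _; rewrite lee_fin powR_ge0.
have young : (\int[mu]_x (F s x * G s x `^ (t - 1))%:E <=
    (2 * c)^-1%:E * \int[mu]_x (G s x `^ t)%:E + K%:E * \int[mu]_x (F s x `^ t)%:E)%E.
  rewrite -ge0_integral_lincomb//; try exact: ltW; try by move=> x; exact: powR_ge0.
  have mFG : measurable_fun setT (fun x => F s x * G s x `^ (t - 1)).
    by apply: measurable_funM => //; exact: measurable_weighted_sum.
  apply: ge0_integral_le => //.
  - by move=> x; rewrite mulr_ge0 ?powR_ge0 ?weighted_sum_ge0.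
  - by apply: measurable_funD; apply: measurable_funM.
  - move=> x; have := powR_young t1 e0 (weighted_sum_ge0 Q s x) (weighted_sum_ge0 U s x).
    by rewrite invrK.
have cND : N%:R * D <= c by rewrite lerDl.
exact: (absorb_half c0 K0 cND IFG0 IG0 IGfin IF0 IGle young).
Qed.

End laminar.

(** * Laminar hulls and colourings *)

Section laminar_hulls.
Context d (T : measurableType d).
Variables (I : eqType) (V W : I -> set T) (sc : I -> int).

(** The hulls are built from the smallest cubes upwards: the hull of i is V_i together
with all the hulls of smaller scale that meet V_i. The nesting hypothesis on V
and W keeps the hull of i inside W_i, and the sets W of one scale are disjoint. If
a smaller hull U_k meets the hull of i, it meets V_i or one of the U_l that were
added; as U_k and U_l are then comparable, U_k itself is contained in the hull. *)
Lemma laminar_hulls (s : seq I) :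
  (forall i, measurable (V i)) -> (forall i, V i `<=` W i) ->
  {in s &, forall i k, sc k < sc i -> W k `&` V i !=set0 -> W k `<=` W i} ->
  {in s &, forall i k, i != k -> sc i = sc k -> W i `&` W k = set0} ->
  uniq s -> pairwise (fun i k => sc k <= sc i) s ->
  exists U : I -> set T, [/\ forall i, measurable (U i),
    forall i, V i `<=` U i, forall i, U i `<=` W i & laminar U s].
Proof.
move=> mV VW; elim: s => [|i s IH] nest disj; first by move=> _ _; exists V; split => // i x.
move=> /= /andP[is_ us] /andP[/allP si ss].
have [||//|//|U' [mU' VU' U'W lam']] := IH.
  by move=> x y xs ys; apply: nest; rewrite inE ?xs ?ys orbT.
  by move=> x y xs ys; apply: disj; rewrite inE ?xs ?ys orbT.
pose K := [set k | [/\ k \in s, sc k < sc i & U' k `&` V i !=set0]].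
pose H := V i `|` \bigcup_(k in K) U' k.
exists (fun k => if k == i then H else U' k); split.
- move=> k; case: eqP => // _; apply: measurableU => //.
  apply: fin_bigcup_measurable => //.
  by apply: (sub_finite_set _ (finite_seq s)) => x [].
- by move=> k; case: eqP => [->|_ //]; exact: subsetUl.
- move=> k; case: eqP => [->|_ //]; rewrite subUset; split => //.
  move=> x [l [ls sl [y [Uy Vy]]] Ux].
  apply: (nest i l); rewrite ?mem_head// ?inE ?ls ?orbT//; last exact: U'W.
  by exists y; split => //; exact: U'W.
have comparable m k : m \in s -> k \in s ->
    [\/ U' m `&` U' k = set0, U' k `<=` U' m | U' m `<=` U' k].
  move=> {nest disj IH is_ us si ss K H}; elim: s lam' => // l s IH.
  rewrite /laminar /= => /andP[/allP ls lams].
  rewrite !inE => /predU1P[->|ms] /predU1P[->|ks].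
  - by constructor 2.
  - by have /asboolP[] := ls _ ks; [constructor 1|constructor 2].
  - by have /asboolP[] := ls _ ms; [rewrite setIC; constructor 1|constructor 3].
  - exact: IH.
have neq k : k \in s -> (k == i) = false.
  by move=> ks; apply/negP => /eqP ki; move: is_; rewrite -ki ks.
rewrite /laminar /= eqxx; apply/andP; split.
  apply/allP => k ks; rewrite neq//; apply/asboolP.
  have [sck|sck] := ltP (sc k) (sc i); last first.
    left; rewrite -subset0 => x [Hx Ux].
    have scE : sc i = sc k by apply/eqP; rewrite eq_le sck si.
    rewrite -(disj i k _ _ _ scE) ?mem_head ?inE ?ks ?orbT//; last by rewrite eq_sym neq.
    split; last exact: U'W.
    case: Hx => [|[l [ls sl [y [Uy Vy]]] Ulx]]; first exact: VW.
    apply: (nest i l); rewrite ?mem_head// ?inE ?ls ?orbT//; last exact: U'W.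
    by exists y; split => //; exact: U'W.
  have [kH|kH] := pselect (U' k `<=` H); [by right|left].
  have noV : ~ (U' k `&` V i !=set0).
    by move=> Ki; apply: kH => x Ux; right; exists k.
  rewrite -subset0 => x [[Vx|[l [ls sl Kl] Ulx]] Ux].
    by apply: noV; exists x.
  case: (comparable l k ls ks) => [lk0|kl|lk].
  - by rewrite -lk0.
  - by apply: kH => y Uy; right; exists l => //; exact: kl.
  - by apply: noV; case: Kl => y [Uy Vy]; exists y; split => //; exact: lk.
apply: (@sub_in_pairwise _ (mem s) _ _ _ s _ lam'); last by apply/allP => x xs.
by move=> x y xs ys; rewrite (neq _ xs) (neq _ ys).
Qed.

End laminar_hulls.

Section comparison.
Context d (T : measurableType d) (R : realType) (mu : {measure set T -> \bar R}).
Variables (I : eqType) (K : finType) (col : I -> K) (sc : I -> int).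
Variables (Q V W : I -> set T) (a : I -> R) (D : R).
Hypothesis a0 : forall i, 0 <= a i.
Hypotheses (mQ : forall i, measurable (Q i)) (mV : forall i, measurable (V i)).
Hypothesis mW : forall i, measurable (W i).
Hypotheses (QV : forall i, Q i `<=` V i) (VW : forall i, V i `<=` W i).
Hypotheses (D0 : 0 <= D) (Wfin : forall i, (mu (W i) < +oo)%E).
Hypothesis WQ : forall i, (mu (W i) <= D%:E * mu (Q i))%E.
Hypothesis nest : forall i k, col i = col k -> sc k < sc i ->
  W k `&` V i !=set0 -> W k `<=` W i.
Hypothesis disj : forall i k, col i = col k -> sc i = sc k -> i != k ->
  W i `&` W k = set0.

Definition hull_constant (t : R) : R := if t <= 1 then D else hull_constant_ge1 t D.

Lemma hull_constant_ge0 t : 0 <= hull_constant t.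
Proof.
rewrite /hull_constant; case: ifP => // _; rewrite /hull_constant_ge1.
by rewrite !mulr_ge0 ?powR_ge0// addr_ge0// mulr_ge0.
Qed.

Lemma monochrome_comparison (s : seq I) (t : R) : 0 < t -> uniq s ->
  {in s &, forall i k, col i = col k} ->
  (\int[mu]_x (weighted_sum a V s x `^ t)%:E <=
   (hull_constant t)%:E * \int[mu]_x (weighted_sum a Q s x `^ t)%:E)%E.
Proof.
move=> t0 us mono; pose r i k := sc k <= sc i.
have rtot : total r by move=> i k; exact: le_total.
have rtr : transitive r by move=> i k l ki il; exact: le_trans il ki.
have sortE E x : weighted_sum a E s x = weighted_sum a E (sort r s) x.
  by rewrite /weighted_sum; apply: perm_big; rewrite perm_sym perm_sort.
under eq_integral do rewrite sortE.
under [X in (_ <= _ * X)%E]eq_integral do rewrite sortE.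
have [i k|i k|||U [mU VU UW lam]] := @laminar_hulls _ _ _ V W sc (sort r s) mV VW.
- by rewrite !mem_sort => is_ ks; apply: nest; exact: mono.
- by rewrite !mem_sort => is_ ks ik scik; apply: disj => //; exact: mono.
- by rewrite sort_uniq.
- by rewrite -sorted_pairwise// sort_sorted.
have mE E t' : (forall i, measurable (E i)) ->
    measurable_fun setT (fun x => weighted_sum a E (sort r s) x `^ t').
  move=> mE; apply: (measurableT_comp (measurable_powR _)) => //.
  exact: measurable_weighted_sum.
apply: (@le_trans _ _ (\int[mu]_x (weighted_sum a U (sort r s) x `^ t)%:E)%E).
  apply: ge0_integral_le => [x|||x]; [exact: powR_ge0|exact: mE|exact: mE|].
  apply: ge0_ler_powR; rewrite ?nnegrE ?weighted_sum_ge0 ?(ltW t0)//.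
  exact: weighted_sum_le.
have Ufin i : (mu (U i) < +oo)%E.
  by apply: le_lt_trans (Wfin i); apply: le_measure; rewrite ?inE.
have UQ i : (mu (U i) <= D%:E * mu (Q i))%E.
  by apply: le_trans (WQ i); apply: le_measure; rewrite ?inE.
have QU i : Q i `<=` U i by move=> x /QV /VU.
rewrite /hull_constant; case: (leP t 1) => t1.
  by apply: laminar_integral_le1 => //; rewrite t0.
by apply: laminar_integral_ge1 => //; exact: ltW.
Qed.

(** Each colour is treated separately; the power of a sum of #|K| terms is at most
#|K|^t times the sum of the powers. *)
Lemma comparison (s : seq I) (t : R) : 0 < t -> uniq s ->
  (\int[mu]_x (weighted_sum a V s x `^ t)%:E <=
   ((#|K|%:R `^ t) * (#|K|%:R * hull_constant t))%:E *
   \int[mu]_x (weighted_sum a Q s x `^ t)%:E)%E.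
Proof.
move=> t0 us; pose part c := [seq i <- s | col i == c].
have partE E x : weighted_sum a E s x = \sum_(c <- index_enum K) weighted_sum a E (part c) x.
  rewrite /weighted_sum (partition_big col xpredT)//=; apply: eq_bigr => c _.
  by rewrite big_filter.
have mE E s' t' : (forall i, measurable (E i)) ->
    measurable_fun setT (fun x => weighted_sum a E s' x `^ t').
  move=> mE; apply: (measurableT_comp (measurable_powR _)) => //.
  exact: measurable_weighted_sum.
have sz : size (index_enum K) = #|K| by rewrite cardT enumT.
set IQ := (\int[mu]_x (weighted_sum a Q s x `^ t)%:E)%E.
have IQ0 : (0 <= IQ)%E by apply: integral_ge0 => x _; rewrite lee_fin powR_ge0.
have part_le c : (\int[mu]_x (weighted_sum a V (part c) x `^ t)%:E <=
    (hull_constant t)%:E * IQ)%E.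
  apply: (@le_trans _ _ ((hull_constant t)%:E *
      \int[mu]_x (weighted_sum a Q (part c) x `^ t)%:E)%E).
    apply: monochrome_comparison => //; first exact: filter_uniq.
    by move=> i k; rewrite !mem_filter => /andP[/eqP -> _] /andP[/eqP -> _].
  apply: lee_wpmul2l; first by rewrite lee_fin hull_constant_ge0.
  apply: ge0_integral_le => [x|||x]; [exact: powR_ge0|exact: mE|exact: mE|].
  apply: ge0_ler_powR; rewrite ?nnegrE ?weighted_sum_ge0 ?(ltW t0)//.
  rewrite /weighted_sum big_filter big_mkcond /=; apply: ler_sum => i _.
  by case: ifP => // _; rewrite mulr_ge0.
apply: (@le_trans _ _ (\int[mu]_x ((#|K|%:R `^ t)%:E *
    \sum_(c <- index_enum K) (weighted_sum a V (part c) x `^ t)%:E))%E).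
  apply: ge0_le_integral => //.
  - by move=> x _; rewrite lee_fin powR_ge0.
  - by apply/measurable_EFinP; exact: mE.
  - apply: measurable_funeM; apply: emeasurable_sum => c.
    by apply/measurable_EFinP; exact: mE.
  move=> x _; rewrite sumEFin -EFinM lee_fin partE -sz.
  by apply: powR_sum_le => // c; exact: weighted_sum_ge0.
have mp c : measurable_fun setT (fun x => (weighted_sum a V (part c) x `^ t)%:E).
  by apply/measurable_EFinP; exact: mE.
have p0 c x : [set: T] x -> (0 <= (weighted_sum a V (part c) x `^ t)%:E)%E.
  by move=> _; rewrite lee_fin powR_ge0.
rewrite ge0_integralZl ?lee_fin ?powR_ge0//; first last.
- by move=> x _; apply: sume_ge0 => c _; exact: p0.
- exact: emeasurable_sum.
rewrite ge0_integral_sum//.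
rewrite EFinM -muleA; apply: lee_wpmul2l; first by rewrite lee_fin powR_ge0.
rewrite EFinM -muleA; apply: (@le_trans _ _ (\sum_(c <- index_enum K) ((hull_constant t)%:E * IQ))%E).
  by apply: lee_sum => c _; exact: part_le.
have Y0 : (0 <= (hull_constant t)%:E * IQ)%E by rewrite mule_ge0// lee_fin hull_constant_ge0.
rewrite -sz; elim: (index_enum K) => [|c r IH]; first by rewrite big_nil mul0e.
rewrite big_cons /= -natr1 addrC EFinD ge0_muleDl// mul1e; exact: leeD.
Qed.

End comparison.

(** * The geometry of dilated cubes *)

Section cubes.
Variables (R : realType) (n : nat).
Local Notation Zd := 'cV[int]_n.+1.
Local Notation Rd := 'cV[R]_n.+1.
Local Notation toR := (map_mx (intr : int -> R)).
Local Notation mu := (lebesgue_cV R n.+1).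
Implicit Types (A B : 'M[R]_n.+1) (j : int) (k m : Zd) (r : R).

(** The dilate of radius r, in the geometry of A^j, around the cube of scale j at k;
written as a preimage, it is visibly measurable. *)
Definition lattice_ball A r j k : set (borel_cV R n.+1) :=
  [set x | mx_bounded r (A ^ (- j) *m x - toR k)].

Let subE (x y : Rd) i l : (x - y) i l = x i l - y i l.
Proof. by rewrite mxE [X in _ + X]mxE. Qed.

Lemma lattice_ballW A r s j k : r <= s -> lattice_ball A r j k `<=` lattice_ball A s j k.
Proof. by move=> rs x; exact: mx_boundedW. Qed.

Lemma mulmx_exprz A j x : A \in unitmx -> A ^ j *m (A ^ (- j) *m x) = x :> Rd.
Proof.
by move=> Au; rewrite mulmxA -[_ *m A ^ _]/(_ * _) -exprzDr// subrr expr0z mul1mx.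
Qed.

Lemma mulmx_exprzV A j x : A \in unitmx -> A ^ (- j) *m (A ^ j *m x) = x :> Rd.
Proof.
by move=> Au; rewrite mulmxA -[_ *m A ^ _]/(_ * _) -exprzDr// addNr expr0z mul1mx.
Qed.

Lemma dilated_cubeE A j k : A \in unitmx ->
  dilated_cube A j k = [set x | forall i, 0 <= (A ^ (- j) *m x - toR k) i 0 <= 1].
Proof.
move=> Au; apply/seteqP; split => [_ [x x01 <-] i|x x01].
  by rewrite mulmx_exprzV// addrK; exact: x01.
exists (A ^ (- j) *m x - toR k); first exact: x01.
by rewrite subrK mulmx_exprz.
Qed.

Lemma dilated_cube_lattice_ball A r j k : A \in unitmx -> 1 <= r ->
  dilated_cube A j k `<=` lattice_ball A r j k.
Proof.
move=> Au r1 x; rewrite dilated_cubeE// => x01 i l; rewrite ord1.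
by have := x01 i; rewrite ler_norml => /andP[x0 x1]; apply/andP; split; lra.
Qed.

Let measurable_rows A (f : 'I_n.+1 -> interval R) :
  measurable [set x : borel_cV R n.+1 | forall i, (A *m (x : Rd)) i 0 \in f i].
Proof.
rewrite (_ : [set x | _] = \bigcap_(i in [set: 'I_n.+1])
    ((fun x : borel_cV R n.+1 => (A *m x) i 0 : measurableTypeR R) @^-1` [set` f i])).
  apply: fin_bigcap_measurable => // i _.
  by have := measurable_mx_row A i measurableT (measurable_itv (f i)); rewrite setTI.
by apply/seteqP; split => [x h i _|x h i]; [exact: h|exact: (h i I)].
Qed.

Let measurable_box (a b : R) :
  measurable [set x : borel_cV R n.+1 | forall i, a <= (x : Rd) i 0 <= b].
Proof.
rewrite (_ : [set x | _] =
    [set x : borel_cV R n.+1 | forall i, (1%:M *m x) i 0 \in `[a, b]]).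
  exact: measurable_rows.
by apply/seteqP; split => x h i; have := h i; rewrite in_itv /= mul1mx.
Qed.

Lemma measurable_lattice_ball A r j k : measurable (lattice_ball A r j k).
Proof.
rewrite (_ : lattice_ball _ _ _ _ = [set x | forall i, (A ^ (- j) *m x) i 0 \in
    `[toR k i 0 - r, toR k i 0 + r]]); first exact: measurable_rows.
apply/seteqP; split => x h i.
  by have := h i 0; rewrite in_itv /= subE ler_norml; lra.
by move=> l; have := h i; rewrite ord1 in_itv /= subE ler_norml; lra.
Qed.

Lemma measurable_dilated_cube A j k : A \in unitmx ->
  measurable (dilated_cube A j k : set (borel_cV R n.+1)).
Proof.
move=> Au; rewrite dilated_cubeE//.
rewrite (_ : [set x | _] = [set x : borel_cV R n.+1 | forall i, (A ^ (- j) *m x) i 0 \in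
    `[toR k i 0, toR k i 0 + 1]]); first exact: measurable_rows.
apply/seteqP; split => x h i.
  by have := h i; rewrite in_itv /= subE; lra.
by have := h i; rewrite in_itv /= subE; lra.
Qed.

(** The integer vectors with entries in [-N, N]. *)
Definition lattice_window (N : nat) : seq Zd :=
  [seq \col_i ((f i : nat)%:Z - N%:Z) | f : {ffun 'I_n.+1 -> 'I_(N + N).+1}].

Lemma mem_lattice_window (N : nat) m : (forall i, `|m i 0| <= N%:Z) -> m \in lattice_window N.
Proof.
move=> mN; apply/mapP.
have mP i : (absz (m i 0%R + N%:Z)%R < (N + N).+1)%N.
  have := mN i; rewrite ler_norml => /andP[m1 m2].
  rewrite ltnS -lez_nat gez0_abs; last by lra.
  by rewrite PoszD lerD2r.
exists [ffun i => Ordinal (mP i)]; first by rewrite mem_enum.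
apply/matrixP => i l; rewrite ord1 !mxE ffunE /= gez0_abs ?addrK//.
by have := mN i; rewrite ler_norml => /andP[m1 m2]; lra.
Qed.

Lemma lattice_ball_cover A r (N : nat) j k x : A \in unitmx -> r + 1 <= N%:R ->
  lattice_ball A r j k x ->
  exists2 m, m \in lattice_window N & dilated_cube A j (k + m) x.
Proof.
move=> Au rN xr; pose y := A ^ (- j) *m x.
exists (map_mx Num.floor y - k).
  apply: mem_lattice_window => i; rewrite -(ler_int R) intr_norm.
  have := xr i 0; rewrite subE -/y => h.
  have -> : (map_mx Num.floor y - k) i 0 = Num.floor (y i 0) - k i 0 by rewrite !mxE.
  rewrite intrD rmorphN /=.
  have /andP[f1 f2] := floor_itv (y i 0); rewrite intrD in f2.
  move: h; rewrite [toR k i 0]mxE !ler_norml => /andP[h1 h2].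
  rewrite -[N%:Z%:~R]/(N%:R : R).
  by apply/andP; split; lra.
rewrite dilated_cubeE// => i; rewrite addrCA subrr addr0 -/y subE.
have -> : toR (map_mx Num.floor y) i 0 = (Num.floor (y i 0))%:~R by rewrite !mxE.
have /andP[f1 f2] := floor_itv (y i 0); rewrite intrD in f2.
by apply/andP; split; lra.
Qed.

Lemma dilated_cube_translate A j k : A \in unitmx ->
  mu (dilated_cube A j k) = mu (dilated_cube A j 0).
Proof.
move=> Au; rewrite -(lebesgue_cV_translation (A ^ j *m toR k)); last exact: measurable_dilated_cube.
congr (mu _); rewrite !dilated_cubeE//; apply/seteqP.
have E (x : Rd) : A ^ (- j) *m (x + A ^ j *m toR k) - toR k = A ^ (- j) *m x - toR 0.
  by rewrite mulmxDr mulmx_exprzV// addrK map_mx0 subr0.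
by split => x /= h i; [rewrite -E|rewrite E]; exact: h.
Qed.

Lemma measure_cover_le (I : eqType) (s : seq I) (X : set (borel_cV R n.+1))
    (E : I -> set (borel_cV R n.+1)) : measurable X -> (forall i, measurable (E i)) ->
  (forall x, X x -> exists2 i, i \in s & E i x) ->
  (mu X <= \sum_(i <- s) mu (E i))%E.
Proof.
move=> mX mE; elim: s X mX => [|i s IH] X mX XE.
  rewrite big_nil (_ : X = set0) ?measure0// -subset0 => x /XE[l].
  by rewrite in_nil.
rewrite big_cons; apply: (@le_trans _ _ (mu (E i) + mu (X `\` E i))%E).
  apply: le_trans (measureU2 _ (mE i) _); last exact: measurableD.
  apply: le_measure; rewrite ?inE//.
    by apply: measurableU => //; exact: measurableD.
  by move=> x Xx; have [Ex|Ex] := pselect (E i x); [left|right].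
apply: leeD2l; apply: IH; first exact: measurableD.
move=> x [Xx Ex]; have [l] := XE x Xx; rewrite inE => /predU1P[->//|ls El].
by exists l.
Qed.

Lemma mu_lattice_ball_le A r (N : nat) j k l : A \in unitmx -> r + 1 <= N%:R ->
  (mu (lattice_ball A r j k) <=
   (size (lattice_window N))%:R%:E * mu (dilated_cube A j l))%E.
Proof.
move=> Au rN.
apply: (le_trans (measure_cover_le (measurable_lattice_ball A r j k)
  (fun m => measurable_dilated_cube j (k + m) Au) (fun x => lattice_ball_cover Au rN))).
rewrite dilated_cube_translate//; elim: (lattice_window N) => [|m s IH].
  by rewrite big_nil mul0e.
rewrite big_cons /= -natr1 addrC EFinD ge0_muleDl// mul1e dilated_cube_translate//.
exact: leeD.
Qed.

Lemma mu_lattice_ball_lty A r j k : A \in unitmx -> (mu (lattice_ball A r j k) < +oo)%E.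
Proof.
move=> Au; have [a a0 Aa] := mx_bounded_exists (A ^ j).
have [b b0 kb] := mx_bounded_exists (toR k).
pose M := n.+1%:R * a * (`|r| + b).
have M0 : 0 <= M by rewrite !mulr_ge0// addr_ge0.
apply: (@le_lt_trans _ _ (mu [set x | forall i, - M <= x i 0 <= M])); last first.
  by rewrite lebesgue_cV_box ?ltry//; lra.
apply: le_measure; rewrite ?inE.
- exact: measurable_lattice_ball.
- exact: measurable_box.
move=> x xr i; rewrite -ler_norml -(mulmx_exprz j x Au).
apply: mx_boundedM => //; rewrite -[A ^ _ *m x](subrK (toR k)).
by apply: mx_boundedD => //; apply: mx_boundedW xr; exact: ler_norm.
Qed.

(** Finitely many translates of the cube cover the unit cube. *)
Lemma mu_dilated_cube_gt0 A j k : A \in unitmx -> (0 < mu (dilated_cube A j k))%E.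
Proof.
move=> Au; have [a a0 Aa] := mx_bounded_exists (A ^ (- j)).
pose r := n.+1%:R * a * 1; pose N := (Num.truncn (r + 1)).+1.
have rN : r + 1 <= N%:R by exact/ltW/truncnS_gt.
rewrite lt0e measure_ge0 andbT; apply/eqP => mu0.
have := mu_lattice_ball_le j 0 k Au rN; rewrite mu0 mule0 => ball0.
pose X := [set x : borel_cV R n.+1 | forall i, 0 <= (x : Rd) i 0 <= 1].
have : (mu X <= mu (lattice_ball A r j 0))%E.
  apply: le_measure; rewrite ?inE.
  - exact: measurable_box.
  - exact: measurable_lattice_ball.
  move=> x x01; rewrite /lattice_ball /= map_mx0 subr0; apply: mx_boundedM => // i l.
  by rewrite ord1 ger0_norm; case/andP: (x01 i).
move=> /le_trans/(_ ball0); rewrite lebesgue_cV_box// subr0 expr1n.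
by rewrite lee_fin ler10.
Qed.

Lemma mu_dilated_cube_lty A j k : A \in unitmx -> (mu (dilated_cube A j k) < +oo)%E.
Proof.
move=> Au; apply: le_lt_trans (mu_lattice_ball_lty 1 j k Au).
apply: le_measure; rewrite ?inE.
- exact: measurable_dilated_cube.
- exact: measurable_lattice_ball.
- exact: dilated_cube_lattice_ball.
Qed.

Lemma mu_dilated_cubeE A j : A \in unitmx ->
  exists2 w : R, 0 < w & forall k, mu (dilated_cube A j k) = w%:E.
Proof.
move=> Au; have fin0 : mu (dilated_cube A j 0) \is a fin_num.
  by rewrite ge0_fin_numE ?measure_ge0//; exact: mu_dilated_cube_lty.
exists (fine (mu (dilated_cube A j 0))) => [|k].
  by rewrite -lte_fin fineK//; exact: mu_dilated_cube_gt0.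
by rewrite fineK; [exact: dilated_cube_translate|exact: fin0].
Qed.

(** Cubes of one colour have scales that differ by multiples of L + 1, and positions
that differ by multiples of M + 1 in every coordinate. *)
Definition scale_position_colour (L M : nat) (i : int * Zd) :
    'I_L.+1 * {ffun 'I_n.+1 -> 'I_M.+1} :=
  (inord `|(i.1 %% L.+1)%Z|%N, [ffun l => inord `|(i.2 l ord0 %% M.+1)%Z|%N]).

Let eqz_mod_of_inord (L : nat) (x y : int) :
  inord `|(x %% L.+1)%Z|%N = inord `|(y %% L.+1)%Z|%N :> 'I_L.+1 ->
  exists z : int, x - y = z * L.+1%:Z.
Proof.
move=> /(congr1 (@nat_of_ord _)).
have lt z : (`|(z %% L.+1)%Z|%N < L.+1)%N.
  by rewrite -ltz_nat gez0_abs ?modz_ge0// ltz_pmod.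
rewrite !inordK// => /(congr1 Posz); rewrite !gez0_abs ?modz_ge0// => xy.
exists ((x %/ L.+1)%Z - (y %/ L.+1)%Z).
by rewrite {1}(divz_eq x L.+1) {1}(divz_eq y L.+1) xy mulrBl opprD addrACA subrr addr0.
Qed.

Lemma lattice_ball_disjoint A r (L M : nat) j k k' : 4 * r <= M%:R ->
  scale_position_colour L M (j, k) = scale_position_colour L M (j, k') -> k != k' ->
  lattice_ball A (2 * r) j k `&` lattice_ball A (2 * r) j k' = set0.
Proof.
move=> rM [/ffunP colE] kk'; rewrite -subset0 => x [xk xk'].
case/negP: kk'; apply/eqP/matrixP => i l; rewrite ord1.
have := colE i; rewrite !ffunE /= => /eqz_mod_of_inord[z zE].
have kk : `|toR k i 0 - toR k' i 0| <= 4 * r.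
  have := xk i 0; have := xk' i 0; rewrite !subE !ler_norml => /andP[h1 h2] /andP[h3 h4].
  by apply/andP; split; lra.
have z0 : z = 0.
  apply/eqP; rewrite -normr_le0 leNgt; apply/negP => z1.
  have {}z1 : 1 <= `|z| by rewrite -gtz0_ge1.
  have : M.+1%:R <= `|toR k i 0 - toR k' i 0|.
    rewrite !mxE -intrB zE intrM normrM [X in _ * X]ger0_norm//.
    rewrite -[leLHS]mul1r; apply: ler_wpM2r => //.
    by rewrite -intr_norm ler1z.
  by move=> /le_trans/(_ kk); rewrite -natr1; lra.
by move: zE; rewrite z0 mul0r => /eqP; rewrite subr_eq0 => /eqP.
Qed.

(** The scales differ by at least L + 1, so in the coordinates of the larger cube the
smaller dilate has diameter at most 4 r d e <= r. *)
Lemma lattice_ball_nested A r e (L M : nat) j k j' k' : A \in unitmx -> 0 <= r ->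
  (forall m : nat, (L.+1 <= m)%N -> mx_bounded e (A ^- m)) -> n.+1%:R * e * 4 <= 1 ->
  scale_position_colour L M (j, k) = scale_position_colour L M (j', k') -> j' < j ->
  lattice_ball A (2 * r) j' k' `&` lattice_ball A r j k !=set0 ->
  lattice_ball A (2 * r) j' k' `<=` lattice_ball A (2 * r) j k.
Proof.
move=> Au r0 small e1 [/eqz_mod_of_inord[z zE] _] jj' [x [xk' xk]] y yk'.
have z0 : 0 < z.
  have : 0 < z * L.+1%:Z by rewrite -zE subr_gt0.
  by rewrite pmulr_lgt0.
have jE : - j = - (z * L.+1%:Z) + - j' by rewrite -zE; ring.
have Ajj' (w : Rd) : A ^ (- j) *m w = A ^ (- (z * L.+1%:Z)) *m (A ^ (- j') *m w).
  by rewrite mulmxA jE exprzDr.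
have zsmall : mx_bounded e (A ^ (- (z * L.+1%:Z))).
  have [N NE] : exists N : nat, z * L.+1%:Z = N%:Z.
    by exists (absz (z * L.+1%:Z)); rewrite gez0_abs// mulr_ge0// ltW.
  have NL : (L.+1 <= N)%N.
    by rewrite -lez_nat -NE ler_peMl// -gtz0_ge1.
  by rewrite NE -exprnN; exact: small.
rewrite /lattice_ball /=.
have -> : A ^ (- j) *m y - toR k = (A ^ (- (z * L.+1%:Z)) *m
   ((A ^ (- j') *m y - toR k') - (A ^ (- j') *m x - toR k'))) + (A ^ (- j) *m x - toR k).
  rewrite [- (_ - toR k')]opprB [_ + (toR k' - _)]addrA subrK mulmxBr -!Ajj'.
  by rewrite addrA subrK.
apply: (@mx_boundedW _ _ _ (n.+1%:R * e * (2 * r + 2 * r) + r)).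
  have : n.+1%:R * e * 4 * r <= 1 * r by rewrite ler_wpM2r.
  by lra.
by apply: mx_boundedD => //; apply: mx_boundedM => //; exact: mx_boundedB.
Qed.

Definition borel_cube A (i : int * Zd) : set (borel_cV R n.+1) := dilated_cube A i.1 i.2.

Lemma cube_comparison A r : A \in unitmx -> expansive A -> 1 <= r ->
  exists (N : nat) (D : R), [/\ (0 < N)%N, 0 <= D &
    forall (a : int * Zd -> R) (s : seq (int * Zd)) (t : R),
      (forall i, 0 <= a i) -> 0 < t -> uniq s ->
    (\int[mu]_x (weighted_sum a (fun i => lattice_ball A r i.1 i.2) s x `^ t)%:E <=
     (N%:R `^ t * (N%:R * hull_constant D t))%:E *
     \int[mu]_x (weighted_sum a (borel_cube A) s x `^ t)%:E)%E].
Proof.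
move=> Au expA r1; have r0 : 0 <= r by rewrite (le_trans _ r1).
(* the value required by lattice_ball_nested *)
pose e : R := (n.+1%:R * 4)^-1.
have e0 : 0 < e by rewrite invr_gt0 mulr_gt0.
have [[//|L] _ LP] := expansive_pow_small Au expA e0.
pose M := (Num.truncn (4 * r)).+1; have rM : 4 * r <= M%:R by exact/ltW/truncnS_gt.
pose N := (Num.truncn (2 * r + 1)).+1; have rN : 2 * r + 1 <= N%:R by exact/ltW/truncnS_gt.
pose K : finType := ('I_L.+1 * {ffun 'I_n.+1 -> 'I_M.+1})%type.
have K0 : (0 < #|K|)%N.
  by apply/card_gt0P; exists (ord0, [ffun=> ord0]).
exists #|K|, (size (lattice_window N))%:R; split => // a s t a0 t0 us.
apply: (@comparison _ _ _ mu _ K (scale_position_colour L M) fst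
  (borel_cube A) (fun i => lattice_ball A r i.1 i.2)
  (fun i => lattice_ball A (2 * r) i.1 i.2)) => //.
- by move=> i; exact: measurable_dilated_cube.
- by move=> i; exact: measurable_lattice_ball.
- by move=> i; exact: measurable_lattice_ball.
- by move=> i; exact: dilated_cube_lattice_ball.
- by move=> i; apply: lattice_ballW; lra.
- by move=> i; exact: mu_lattice_ball_lty.
- by move=> i; exact: mu_lattice_ball_le.
- move=> [j k] [j' k'] /= col jj'; apply: (lattice_ball_nested Au r0 LP _ col jj').
  rewrite /e; have -> // : n.+1%:R * (n.+1%:R * 4)^-1 * 4 = 1 :> R.
  by rewrite mulrAC divff// mulf_neq0// pnatr_eq0.
- move=> [j k] [j' k'] /= col jj'; move: col; rewrite -jj' => col neq.
  have kk' : k != k' by apply: contra neq => /eqP ->.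
  exact: (@lattice_ball_disjoint A r L M j k k' rM col kk').
Qed.

End cubes.

(** * Monotone suprema and countable sums *)

Section monotone_suprema.
Context d (T : measurableType d) (R : realType) (mu : {measure set T -> \bar R}).

Lemma integral_ereal_sup (D : set T) (h : nat -> T -> R) (H : T -> \bar R) :
  measurable D -> (forall m x, 0 <= h m x) -> (forall m, measurable_fun setT (h m)) ->
  (forall x m k, (m <= k)%N -> h m x <= h k x) ->
  (forall x, H x = ereal_sup (range (fun m => (h m x)%:E))) ->
  [/\ measurable_fun setT H,
      forall b, (forall m, (\int[mu]_(x in D) (h m x)%:E <= b)%E) ->
        (\int[mu]_(x in D) H x <= b)%E &
      forall m, (\int[mu]_(x in D) (h m x)%:E <= \int[mu]_(x in D) H x)%E].
Proof.
move=> mD h0 mh hmono HE.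
have hcvg x : (fun m => (h m x)%:E) @ \oo --> H x.
  rewrite HE; apply: ereal_nondecreasing_cvgn => m k mk.
  by rewrite lee_fin; exact: hmono.
have mhE m : measurable_fun setT (fun x => (h m x)%:E) by exact/measurable_EFinP.
have mH : measurable_fun setT H.
  by apply: (@emeasurable_fun_cvg _ _ _ setT (fun m x => (h m x)%:E)) => // x _.
split => //.
- move=> b hb; rewrite (eq_integral (fun x => limn (fun m => (h m x)%:E))); last first.
    by move=> x _; apply/esym/cvg_lim => //; exact: hcvg.
  have mhD m : measurable_fun D (fun x => (h m x)%:E) by exact: measurable_funTS.
  rewrite monotone_convergence//; last 2 first.
  - by move=> m x _; rewrite lee_fin.
  - by move=> x _ m k mk; rewrite lee_fin; exact: hmono.
  apply: lime_le.
    apply: ereal_nondecreasing_is_cvgn => m k mk; apply: ge0_le_integral => //.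
    + by move=> x _; rewrite lee_fin.
    + by move=> x _; rewrite lee_fin; exact: hmono.
  exact: nearW.
- move=> m; apply: ge0_le_integral => //.
  + by move=> x _; rewrite lee_fin.
  + exact: measurable_funTS.
  + exact: measurable_funTS.
  + by move=> x _; rewrite HE; apply: ereal_sup_ubound; exists m.
Qed.

(** Both inequalities come from monotonicity, of the power t and of the power 1/t. *)
Lemma poweR_ereal_sup (y : nat -> R) (t : R) : 0 < t -> (forall m, 0 <= y m) ->
  (ereal_sup (range (fun m => (y m)%:E)) `^ t)%E =
  ereal_sup (range (fun m => (y m `^ t)%:E)).
Proof.
move=> t0 y0; have tn0 : t != 0 by rewrite gt_eqF.
set Y := ereal_sup (range (fun m => (y m)%:E)); set Z := ereal_sup _.
have yY m : ((y m)%:E <= Y)%E by apply: ereal_sup_ubound; exists m.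
have Y0 : (0 <= Y)%E by apply: le_trans (yY 0%N); rewrite lee_fin.
have yZ m : ((y m `^ t)%:E <= Z)%E by apply: ereal_sup_ubound; exists m.
have Z0 : (0 <= Z)%E by apply: le_trans (yZ 0%N); rewrite lee_fin powR_ge0.
have pmono s x z : 0 < s -> (0 <= x)%E -> (x <= z)%E -> (x `^ s <= z `^ s)%E.
  move=> s0 x0 xz; apply: gt0_ler_poweR => //; first exact: ltW.
    by rewrite in_itv /= x0 leey.
  by rewrite in_itv /= (le_trans x0 xz) leey.
apply/eqP; rewrite eq_le; apply/andP; split; last first.
  apply: ge_ereal_sup => _ [m _ <-]; rewrite -poweR_EFin.
  by apply: pmono => //; rewrite lee_fin.
rewrite -[leRHS]poweRe1// -(mulVf tn0) poweRrM; apply: (pmono) => //.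
apply: ge_ereal_sup => _ [m _ <-].
rewrite -[leLHS]poweRe1 ?lee_fin// -(divff tn0) poweRrM poweR_EFin.
by apply: pmono; rewrite ?invr_gt0 ?lee_fin ?powR_ge0.
Qed.

End monotone_suprema.

Section enumeration.
Variables (R : realType) (I : countType).

(** The elements with code below m: an increasing sequence of finite lists that
exhausts the countable type. *)
Definition enum_upto (m : nat) : seq I := pmap (@pickle_inv I) (iota 0 m).

Lemma enum_upto_uniq m : uniq (enum_upto m).
Proof. by rewrite (pmap_uniq (@pickle_invK I))// iota_uniq. Qed.

Lemma mem_enum_upto m i : (i \in enum_upto m) = (pickle i < m)%N.
Proof.
rewrite mem_pmap; apply/mapP/idP => [[l]|im].
  rewrite mem_iota add0n => /andP[_ lm] il.
  by have := pickle_invK (T := I) l; rewrite -il /= => ->.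
by exists (pickle i); [rewrite mem_iota|rewrite pickleK_inv].
Qed.

Lemma size_enum_upto m : (size (enum_upto m) <= m)%N.
Proof. by rewrite size_pmap (leq_trans (count_size _ _))// size_iota. Qed.

Lemma sum_subseq_le (s s' : seq I) (f : I -> R) : (forall i, 0 <= f i) ->
  uniq s -> uniq s' -> {subset s <= s'} -> \sum_(i <- s) f i <= \sum_(i <- s') f i.
Proof.
move=> f0 us us' ss'; rewrite [leRHS](bigID (mem s))/=.
rewrite (_ : \sum_(i <- s' | i \in s) f i = \sum_(i <- s) f i).
  by rewrite lerDl; apply: sumr_ge0.
rewrite -big_filter; apply: perm_big; apply: uniq_perm => //; first exact: filter_uniq.
by move=> i; rewrite mem_filter; case: (boolP (i \in s)) => // /ss' ->.
Qed.

Lemma sum_enum_upto_le (f : I -> R) m k : (forall i, 0 <= f i) -> (m <= k)%N ->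
  \sum_(i <- enum_upto m) f i <= \sum_(i <- enum_upto k) f i.
Proof.
move=> f0 mk; apply: sum_subseq_le => //; rewrite ?enum_upto_uniq// => i.
by rewrite !mem_enum_upto => /leq_trans; apply.
Qed.

Lemma esum_enum_upto (f : I -> R) : (forall i, 0 <= f i) ->
  (\esum_(i in [set: I]) (f i)%:E)%E =
  ereal_sup (range (fun m => (\sum_(i <- enum_upto m) f i)%:E)).
Proof.
move=> f0; apply/eqP; rewrite eq_le; apply/andP; split.
  apply: ge_ereal_sup => _ [A [/finite_seqP[s ->] _] <-].
  have -> : [set` s] = [set` undup s] by apply/seteqP; split => i /=; rewrite mem_undup.
  rewrite -fsbig_seq ?undup_uniq// sumEFin.
  pose m := (\max_(i <- undup s) pickle i).+1.
  apply: (@le_trans _ _ (\sum_(i <- enum_upto m) f i)%:E); last first.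
    by apply: ereal_sup_ubound; exists m.
  rewrite lee_fin; apply: sum_subseq_le; rewrite ?undup_uniq ?enum_upto_uniq// => i is_.
  by rewrite mem_enum_upto ltnS; apply: leq_bigmax_seq.
apply: ge_ereal_sup => _ [m _ <-]; apply: esum_ge; exists [set` enum_upto m].
  by split => //; exact: finite_seq.
by rewrite -fsbig_seq ?enum_upto_uniq// sumEFin.
Qed.

End enumeration.

(** * Comparison of infinite sums and suprema over cubes *)

Section power_of_sums.
Variables (R : realType) (n : nat).
Local Notation Zd := 'cV[int]_n.+1.
Local Notation Idx := (int * 'cV[int]_n.+1)%type.
Local Notation mu := (lebesgue_cV R n.+1).
Implicit Types (A : 'M[R]_n.+1) (r t p q : R) (a w : Idx -> R).

Section fixed_cubes.
Variables (A : 'M[R]_n.+1) (r : R) (E : Idx -> set (borel_cV R n.+1)).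
Hypotheses (Au : A \in unitmx) (expA : expansive A) (r1 : 1 <= r).
Hypothesis mE : forall i, measurable (E i).
Hypothesis E_ball : forall i, E i `<=` lattice_ball A r i.1 i.2.

Let mQ (i : Idx) : measurable (borel_cube A i).
Proof. exact: measurable_dilated_cube. Qed.

Let measurable_power (a : Idx -> R) (F : Idx -> set (borel_cV R n.+1)) s t :
  (forall i, measurable (F i)) -> measurable_fun setT (fun x => weighted_sum a F s x `^ t).
Proof.
move=> mF; apply: (measurableT_comp (measurable_powR _)) => //.
exact: measurable_weighted_sum.
Qed.

Lemma finite_sum_comparison : exists (N : nat) (D : R), [/\ (0 < N)%N, 0 <= D &
    forall a (s : seq Idx) t, (forall i, 0 <= a i) -> 0 < t -> uniq s ->
    (\int[mu]_x (weighted_sum a E s x `^ t)%:E <=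
     (N%:R `^ t * (N%:R * hull_constant D t))%:E *
     \int[mu]_x (weighted_sum a (borel_cube A) s x `^ t)%:E)%E].
Proof.
have [N [D [N0 D0 ND]]] := cube_comparison Au expA r1.
exists N, D; split; [exact: N0|exact: D0|move=> a s t a0 t0 us].
apply: (@le_trans _ _ (\int[mu]_x
  (weighted_sum a (fun i => lattice_ball A r i.1 i.2) s x `^ t)%:E)%E); last exact: ND.
apply: ge0_integral_le => [x|||x]; [exact: powR_ge0|exact: measurable_power|
  by apply: measurable_power => i; exact: measurable_lattice_ball|].
apply: ge0_ler_powR; rewrite ?nnegrE ?weighted_sum_ge0 ?(ltW t0)//.
exact: weighted_sum_le.
Qed.

Definition infinite_sum a (F : Idx -> set (borel_cV R n.+1)) (x : borel_cV R n.+1) : \bar R :=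
  (\esum_(i in [set: Idx]) (a i * \1_(F i) x)%:E)%E.

Lemma infinite_sum_integral a (F : Idx -> set (borel_cV R n.+1)) (X : set (borel_cV R n.+1)) t :
  measurable X -> (forall i, 0 <= a i) -> (forall i, measurable (F i)) -> 0 < t ->
  [/\ measurable_fun setT (fun x => infinite_sum a F x `^ t)%E,
    forall b, (forall m, (\int[mu]_(x in X) (weighted_sum a F (enum_upto Idx m) x `^ t)%:E <= b)%E) ->
        (\int[mu]_(x in X) (infinite_sum a F x `^ t) <= b)%E &
      forall m, (\int[mu]_(x in X) (weighted_sum a F (enum_upto Idx m) x `^ t)%:E <=
        \int[mu]_(x in X) (infinite_sum a F x `^ t))%E].
Proof.
move=> mX a0 mF t0; apply: integral_ereal_sup => //.
- by move=> m x; exact: powR_ge0.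
- by move=> m; exact: measurable_power.
- move=> x m k mk; apply: ge0_ler_powR; rewrite ?nnegrE ?weighted_sum_ge0 ?(ltW t0)//.
  by apply: sum_enum_upto_le => // i; rewrite mulr_ge0.
- move=> x; rewrite /infinite_sum esum_enum_upto; last by move=> i; rewrite mulr_ge0.
  by rewrite poweR_ereal_sup// => m; exact: weighted_sum_ge0.
Qed.

Lemma infinite_sum_integral1 a (F : Idx -> set (borel_cV R n.+1)) (X : set (borel_cV R n.+1)) :
  measurable X -> (forall i, 0 <= a i) -> (forall i, measurable (F i)) ->
  [/\ measurable_fun setT (infinite_sum a F),
    forall b, (forall m, (\int[mu]_(x in X) (weighted_sum a F (enum_upto Idx m) x)%:E <= b)%E) ->
        (\int[mu]_(x in X) (infinite_sum a F x) <= b)%E &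
      forall m, (\int[mu]_(x in X) (weighted_sum a F (enum_upto Idx m) x)%:E <=
        \int[mu]_(x in X) (infinite_sum a F x))%E].
Proof.
move=> mX a0 mF; apply: integral_ereal_sup => //.
- by move=> m x; exact: weighted_sum_ge0.
- by move=> m; exact: measurable_weighted_sum.
- by move=> x m k mk; apply: sum_enum_upto_le => // i; rewrite mulr_ge0.
- by move=> x; rewrite /infinite_sum esum_enum_upto// => i; rewrite mulr_ge0.
Qed.

Lemma infinite_sum_comparison t : 0 < t -> exists2 C : R, 0 <= C &
  forall a, (forall i, 0 <= a i) ->
  (\int[mu]_x (infinite_sum a E x `^ t) <=
   C%:E * \int[mu]_x (infinite_sum a (borel_cube A) x `^ t))%E.
Proof.
move=> t0; have [N [D [N0 D0 ND]]] := finite_sum_comparison.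
have C0 : 0 <= N%:R `^ t * (N%:R * hull_constant D t).
  by rewrite !mulr_ge0 ?powR_ge0 ?hull_constant_ge0.
exists (N%:R `^ t * (N%:R * hull_constant D t)) => // a a0.
have [_ + _] := @infinite_sum_integral a E setT t measurableT a0 mE t0; apply => m.
apply: (le_trans (ND a (enum_upto Idx m) t a0 t0 (enum_upto_uniq _ m))).
apply: lee_wpmul2l; first by rewrite lee_fin.
by have [_ _] := @infinite_sum_integral a (borel_cube A) setT t measurableT a0 mQ t0; apply.
Qed.

Definition infinite_sup w (F : Idx -> set (borel_cV R n.+1)) (x : borel_cV R n.+1) : \bar R :=
  ereal_sup [set (w i * \1_(F i) x)%:E | i in [set: Idx]].

Definition finite_max w (F : Idx -> set (borel_cV R n.+1)) (s : seq Idx) x : R :=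
  \big[Order.max/0]_(i <- s) (w i * \1_(F i) x).

Lemma finite_max_ge0 w F s x : 0 <= finite_max w F s x.
Proof.
rewrite /finite_max; elim: s => [|k s IH]; first by rewrite big_nil.
by rewrite big_cons le_max IH orbT.
Qed.

Lemma finite_max_ge w F s x i : i \in s -> w i * \1_(F i) x <= finite_max w F s x.
Proof.
rewrite /finite_max; elim: s => // k s IH; rewrite inE big_cons le_max => /predU1P[->|/IH ->].
  by rewrite lexx.
by rewrite orbT.
Qed.

Lemma finite_max_le w F s x (b : R) : 0 <= b ->
  (forall i, i \in s -> w i * \1_(F i) x <= b) -> finite_max w F s x <= b.
Proof.
move=> b0; rewrite /finite_max; elim: s => [|k s IH] h; first by rewrite big_nil.
rewrite big_cons ge_max h ?mem_head//=; apply: IH => i is_; apply: h.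
by rewrite inE is_ orbT.
Qed.

Lemma measurable_finite_max w F s : (forall i, measurable (F i)) ->
  measurable_fun setT (finite_max w F s).
Proof.
move=> mF; rewrite /finite_max; elim: s => [|k s IH].
  by under eq_fun do rewrite big_nil; exact: measurable_cst.
under eq_fun do rewrite big_cons; apply: measurable_maxr => //.
by apply: measurable_funM => //; exact: measurable_indic.
Qed.

Lemma infinite_sup_integral w (F : Idx -> set (borel_cV R n.+1)) p :
  (forall i, 0 <= w i) -> (forall i, measurable (F i)) -> 0 < p ->
  [/\ measurable_fun setT (fun x => infinite_sup w F x `^ p)%E,
    forall b, (forall m, (\int[mu]_x (finite_max w F (enum_upto Idx m) x `^ p)%:E <= b)%E) ->
        (\int[mu]_x (infinite_sup w F x `^ p) <= b)%E &
      forall m, (\int[mu]_x (finite_max w F (enum_upto Idx m) x `^ p)%:E <=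
        \int[mu]_x (infinite_sup w F x `^ p))%E].
Proof.
move=> w0 mF p0; apply: integral_ereal_sup => //.
- by move=> m x; exact: powR_ge0.
- move=> m; apply: (measurableT_comp (measurable_powR _)) => //.
  exact: measurable_finite_max.
- move=> x m k mk; apply: ge0_ler_powR; rewrite ?nnegrE ?finite_max_ge0 ?(ltW p0)//.
  apply: finite_max_le => [|i]; first exact: finite_max_ge0.
  rewrite mem_enum_upto => im; apply: finite_max_ge.
  by rewrite mem_enum_upto (leq_trans im).
- move=> x; rewrite -poweR_ereal_sup//; last by move=> m; exact: finite_max_ge0.
  congr (_ `^ _)%E; apply/eqP; rewrite eq_le; apply/andP; split.
    apply: ge_ereal_sup => _ [i _ <-].
    apply: (@le_trans _ _ (finite_max w F (enum_upto Idx (pickle i).+1) x)%:E).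
      by rewrite lee_fin finite_max_ge// mem_enum_upto.
    by apply: ereal_sup_ubound; exists (pickle i).+1.
  apply: ge_ereal_sup => _ [m _ <-].
  have sup_ge i : ((w i * \1_(F i) x)%:E <= infinite_sup w F x)%E.
    by apply: ereal_sup_ubound; exists i.
  have : (0 <= infinite_sup w F x)%E.
    by apply: le_trans (sup_ge (0, 0)); rewrite lee_fin mulr_ge0.
  move: sup_ge; case: (infinite_sup w F x) => [b||] // sup_ge b0.
    by rewrite lee_fin; apply: finite_max_le => // i _; rewrite -lee_fin.
  by rewrite leey.
Qed.

(** A maximum of m numbers w is, up to a factor m^(1/q), the l^q norm of the numbers.
For q = p (m + 1) the exponent t = p / q is 1 / (m + 1), and m^t <= 2; as t <= 1,
the constant of the comparison of sums does not depend on m. *)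
Lemma infinite_sup_comparison p : 0 < p -> exists2 C : R, 0 <= C &
  forall w, (forall i, 0 <= w i) ->
  (\int[mu]_x (infinite_sup w E x `^ p) <=
   C%:E * \int[mu]_x (infinite_sup w (borel_cube A) x `^ p))%E.
Proof.
move=> p0; have [N [D [N0 D0 ND]]] := finite_sum_comparison.
have C0 : 0 <= N%:R * (N%:R * D) * 2 by rewrite !mulr_ge0.
exists (N%:R * (N%:R * D) * 2) => // w w0.
have [_ + _] := @infinite_sup_integral w E p w0 mE p0; apply => m.
(* t = p / q for the exponent q = p (m + 1) *)
pose t : R := m.+1%:R^-1; have t0 : 0 < t by rewrite invr_gt0.
have t1 : t <= 1 by rewrite invf_le1// ler1n.
pose a i := w i `^ (p * m.+1%:R); have a0 i : 0 <= a i by exact: powR_ge0.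
have aE i (u : bool) : (w i * u%:R) `^ p = (a i * u%:R) `^ t.
  case: u; last by rewrite !mulr0 !powR0 ?gt_eqF.
  by rewrite !mulr1 /a -powRrM -mulrA divff ?mulr1// pnatr_eq0.
set s := enum_upto Idx m.
have term_pow F i x : (w i * \1_(F i) x) `^ p = (a i * \1_(F i) x) `^ t.
  by rewrite indicE; exact: aE.
have term0 F i x : 0 <= a i * \1_(F i) x by rewrite mulr_ge0.
have wterm0 F i x : 0 <= w i * \1_(F i) x by rewrite mulr_ge0.
have pow_le (s0 u v : R) : 0 < s0 -> 0 <= u -> u <= v -> u `^ s0 <= v `^ s0.
  move=> s00 u0 uv; apply: ge0_ler_powR; rewrite ?nnegrE// ?(ltW s00)//.
  exact: le_trans uv.
have lower x : finite_max w E s x `^ p <= weighted_sum a E s x `^ t.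
  have S0 := weighted_sum_ge0 a0 E s x.
  rewrite -[leRHS]powRr1 ?powR_ge0// -[X in _ <= _ `^ X](mulVf (lt0r_neq0 p0)) powRrM.
  apply: (pow_le) => //; first exact: finite_max_ge0.
  apply: finite_max_le => [|i is_]; first exact: powR_ge0.
  rewrite -[leLHS]powRr1// -[X in _ `^ X <= _](divff (lt0r_neq0 p0)) powRrM.
  apply: (pow_le); rewrite ?invr_gt0 ?powR_ge0// term_pow; apply: (pow_le) => //.
  rewrite /weighted_sum (big_rem i is_) /= lerDl; exact: sumr_ge0.
have upper x : weighted_sum a (borel_cube A) s x `^ t <=
    2 * finite_max w (borel_cube A) s x `^ p.
  set M := finite_max w _ s x; have M0 : 0 <= M by exact: finite_max_ge0.
  have aM i : i \in s -> a i * \1_(borel_cube A i) x <= M `^ (p * m.+1%:R).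
    move=> is_; rewrite -[leLHS]powRr1// -[X in _ `^ X <= _](divff (lt0r_neq0 t0)).
    rewrite [leLHS]powRrM -term_pow /t invrK powRrM; apply: (pow_le); rewrite ?powR_ge0//.
    by apply: (pow_le) => //; exact: finite_max_ge.
  have : weighted_sum a (borel_cube A) s x <= m%:R * M `^ (p * m.+1%:R).
    apply: (@le_trans _ _ (\sum_(i <- s) M `^ (p * m.+1%:R))).
      by rewrite /weighted_sum !big_seq; apply: ler_sum => i; exact: aM.
    rewrite big_const_seq count_predT iter_addr_0 -[leLHS]mulr_natl.
    by rewrite ler_wpM2r ?powR_ge0// ler_nat size_enum_upto.
  move=> /(pow_le t _ _ t0 (weighted_sum_ge0 a0 _ _ _)) /le_trans; apply.
  rewrite powRM ?powR_ge0// -powRrM /t -mulrA divff ?pnatr_eq0// mulr1.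
  apply: ler_wpM2r; first exact: powR_ge0.
  rewrite -[leRHS]powRr1// -[X in _ <= _ `^ X](divff (_ : m.+1%:R != 0 :> R)) ?pnatr_eq0//.
  rewrite powRrM powR_mulrn//; apply: (pow_le); rewrite ?invr_gt0//.
  rewrite -natrX ler_nat; apply: ltnW.
  by apply: (ltn_trans (ltn_expl m (ltnSn 1))); rewrite ltn_exp2l.
apply: (@le_trans _ _ (\int[mu]_x (weighted_sum a E s x `^ t)%:E)%E).
  apply: ge0_integral_le => [x|||x]; [exact: powR_ge0| |exact: measurable_power|exact: lower].
  apply: (measurableT_comp (measurable_powR _)) => //; exact: measurable_finite_max.
apply: (le_trans (ND a s t a0 t0 (enum_upto_uniq _ m))).
rewrite (EFinM _ 2) -muleA; apply: lee_pmul.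
- by rewrite lee_fin !mulr_ge0 ?powR_ge0 ?hull_constant_ge0.
- by apply: integral_ge0 => x _; rewrite lee_fin powR_ge0.
- rewrite lee_fin /hull_constant t1 ler_wpM2r ?mulr_ge0//.
  by rewrite -[leRHS]powRr1//; apply: ler_powR => //; rewrite ler1n.
have [_ _ /(_ m) supm] := @infinite_sup_integral w (borel_cube A) p w0 mQ p0.
apply: (@le_trans _ _ (2%:E * \int[mu]_x (finite_max w (borel_cube A) s x `^ p)%:E)%E).
  have mm : measurable_fun setT (fun x => finite_max w (borel_cube A) s x `^ p).
    apply: (measurableT_comp (measurable_powR _)) => //; exact: measurable_finite_max.
  rewrite -ge0_integralZl//;
    try by [exact/measurable_EFinP|move=> x _; rewrite lee_fin powR_ge0|rewrite lee_fin].
  apply: ge0_integral_le => [x|||x]; [exact: powR_ge0|exact: measurable_power| |exact: upper].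
  exact: measurable_funM.
by apply: lee_wpmul2l; rewrite ?lee_fin.
Qed.

End fixed_cubes.
End power_of_sums.

(** * Transfer of the sequence space norms *)

(** The final count for p = oo: p' and w are the measures of a B-cube and of an A-cube
of the same scale, Y the integral over the former, and the Z v the integrals over
the neighbouring A-cubes. *)
Lemma average_bound (R : realType) (V : Type) (s : seq V) (w p' D : R) (X Y : \bar R)
    (Z : V -> \bar R) : 0 < p' -> 0 < w -> 0 <= D -> w <= D * p' -> (0 <= X)%E ->
  (forall v, (Z v <= w%:E * X)%E) -> (Y <= D%:E * \sum_(v <- s) Z v)%E ->
  (p'^-1%:E * Y <= (D * D * (size s)%:R)%:E * X)%E.
Proof.
move=> p'0 w0 D0 wp' X0 ZX YZ.
have sumZ : (\sum_(v <- s) Z v <= ((size s)%:R * w)%:E * X)%E.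
  elim: s {YZ} => [|v s IH]; first by rewrite big_nil mul0r mul0e.
  have w00 := ltW w0.
  rewrite big_cons /= -natr1 mulrDl mul1r [(_ + w)%R]addrC EFinD.
  by rewrite ge0_muleDl ?lee_fin ?mulr_ge0//; apply: leeD.
apply: (@le_trans _ _ (p'^-1%:E * (D%:E * (((size s)%:R * w)%:E * X)))%E).
  apply: lee_wpmul2l; first by rewrite lee_fin invr_ge0 ltW.
  by apply: (le_trans YZ); apply: lee_wpmul2l; [rewrite lee_fin|exact: sumZ].
rewrite !muleA -!EFinM; apply: lee_wpmul2r => //.
have wD : w / p' <= D by rewrite ler_pdivrMr.
have -> : p'^-1 * D * ((size s)%:R * w) = D * (size s)%:R * (w / p') by ring.
have -> : D * D * (size s)%:R = D * (size s)%:R * D by ring.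
by rewrite lee_fin ler_wpM2l// mulr_ge0.
Qed.

Section norm_transfer.
Variables (R : realType) (n : nat).
Local Notation Zd := 'cV[int]_n.+1.
Local Notation Idx := (int * 'cV[int]_n.+1)%type.
Local Notation mu := (lebesgue_cV R n.+1).
Implicit Types (A B : 'M[R]_n.+1) (c : coef_seq R n).

Lemma weighted_coef_ge0 A (alpha : R) c j k : 0 <= weighted_coef A alpha c j k.
Proof.
by rewrite mulr_ge0 ?powR_ge0//; case: (c (j, k)) => x y; exact: sqrtr_ge0.
Qed.

Definition moved_cube B (f : int -> Zd -> Zd) (i : Idx) : set (borel_cV R n.+1) :=
  borel_cube B (i.1, f i.1 i.2).

Lemma moved_cube_id A : moved_cube A (fun _ => id) = borel_cube A.
Proof. by apply/funext => -[j k]. Qed.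

Lemma scale_permutation_id c : scale_permutation (fun _ => id) c = c.
Proof. by apply/funext => -[j k]. Qed.

Lemma weighted_term_moved B (alpha : R) (f g : int -> Zd -> Zd) c j k x :
  cancel (f j) (g j) ->
  weighted_term B alpha (scale_permutation g c) j (f j k) x =
  weighted_coef B alpha c j k * \1_(moved_cube B f (j, k)) x.
Proof. by move=> fg; rewrite /weighted_term /weighted_coef /scale_permutation /= fg. Qed.

(** The permuted coefficients on the B-cubes become, after reindexing, the original
coefficients on the moved cubes. *)
Lemma esum_moved B (alpha q : R) (f g : int -> Zd -> Zd) c (J : set int) x :
  0 < q -> (forall j, cancel (f j) (g j)) -> (forall j, cancel (g j) (f j)) ->
  (\esum_(j in J) \esum_(k in [set: Zd])
     (weighted_term B alpha (scale_permutation g c) j k x `^ q)%:E)%E =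
  infinite_sum (fun i => if i.1 \in J then weighted_coef B alpha c i.1 i.2 `^ q else 0)
    (moved_cube B f) x.
Proof.
move=> q0 fg gf; rewrite esum_mkcond.
rewrite (eq_esum (b := fun j => \esum_(k in [set: Zd])
  ((if j \in J then weighted_coef B alpha c j k `^ q else 0) *
    \1_(moved_cube B f (j, k)) x)%:E)%E); last first.
  move=> j _; case: ifPn => _; last first.
    by apply/esym/esum1 => k _; rewrite mul0r.
  rewrite (reindex_esum setT setT (f j)); last first.
    split=> [//|k l _ _ /(can_inj (fg j))//|k _].
    by exists (g j k) => //; exact: gf.
  apply: eq_esum => k _; rewrite weighted_term_moved// indicE.
  case: (_ \in _); first by rewrite !mulr1.
  by rewrite !mulr0 powR0// gt_eqF.
rewrite esum_esum; last first.
  move=> j k _ _; rewrite lee_fin mulr_ge0//; case: ifP => // _; exact: powR_ge0.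
rewrite /infinite_sum; congr esum.
by apply/seteqP; split.
Qed.

Section transfer.
Variables (A B : 'M[R]_n.+1) (f g : int -> Zd -> Zd) (r alpha : R).
Hypotheses (Au : A \in unitmx) (Bu : B \in unitmx) (expA : expansive A) (r1 : 1 <= r).
Hypothesis detAB : `|\det A| = `|\det B|.
Hypotheses (fg : forall j, cancel (f j) (g j)) (gf : forall j, cancel (g j) (f j)).
Hypothesis BA : forall j k, dilated_cube B j (f j k) `<=` lattice_ball A r j k.
Hypothesis AB : forall j k, dilated_cube A j k `<=` lattice_ball B r j (f j k).

Local Notation P := (scale_permutation g).
Let r0 : 0 <= r. Proof. exact: le_trans r1. Qed.

Let coefE c j k : weighted_coef B alpha c j k = weighted_coef A alpha c j k.
Proof. by rewrite /weighted_coef detAB. Qed.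

Let mmoved i : measurable (moved_cube B f i).
Proof. exact: measurable_dilated_cube. Qed.

Let moved_ball i : moved_cube B f i `<=` lattice_ball A r i.1 i.2.
Proof. exact: BA. Qed.

Let poweR_mono (x y : \bar R) (s : R) : 0 < s -> (0 <= x)%E -> (x <= y)%E ->
  (x `^ s <= y `^ s)%E.
Proof.
move=> s0 x0 xy; apply: gt0_ler_poweR => //; first exact: ltW.
  by rewrite in_itv /= x0 leey.
by rewrite in_itv /= (le_trans x0 xy) leey.
Qed.

Let root_transfer (C p : R) (x y : \bar R) : 0 <= C -> 0 < p -> (0 <= x)%E -> (0 <= y)%E ->
  (y <= C%:E * x)%E -> (y `^ p^-1 <= (C `^ p^-1)%:E * x `^ p^-1)%E.
Proof.
move=> C0 p0 x0 y0 yx; rewrite -poweR_EFin -poweRM ?lee_fin//.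
by apply: poweR_mono => //; rewrite invr_gt0.
Qed.

Lemma tl_norm_transfer_fin_fin (p q : R) : 0 < p -> 0 < q -> exists2 C : R, 0 <= C &
  forall c, (tl_norm B alpha p%:E q%:E (P c) <= C%:E * tl_norm A alpha p%:E q%:E c)%E.
Proof.
move=> p0 q0; have t0 : 0 < q^-1 * p by rewrite mulr_gt0// invr_gt0.
have [C C0 CP] := infinite_sum_comparison Au expA r1 mmoved moved_ball t0.
exists (C `^ p^-1); first exact: powR_ge0.
move=> c; pose a (i : Idx) := weighted_coef A alpha c i.1 i.2 `^ q.
have a0 i : 0 <= a i by exact: powR_ge0.
have sumE (M : 'M[R]_n.+1) (F : Idx -> set (borel_cV R n.+1)) (c' : coef_seq R n) :
    (forall x, (\esum_(j in [set: int]) \esum_(k in [set: Zd])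
       (weighted_term M alpha c' j k x `^ q)%:E)%E = infinite_sum a F x) ->
    tl_norm M alpha p%:E q%:E c' =
    ((\int[mu]_x (infinite_sum a F x `^ (q^-1 * p))) `^ p^-1)%E.
  move=> E; rewrite /tl_norm unlock; congr (_ `^ _)%E.
  apply: eq_integral => x _; rewrite E gee0_abs ?poweR_ge0//.
  by rewrite poweRrM.
rewrite (sumE B (moved_cube B f)); last first.
  have aE : (fun i : Idx => if i.1 \in [set: int]
      then weighted_coef B alpha c i.1 i.2 `^ q else 0) = a.
    by apply/funext => i; rewrite in_setT coefE.
  by move=> x; rewrite (esum_moved B alpha c setT x q0 fg gf) aE.
rewrite (sumE A (borel_cube A)); last first.
  move=> x; rewrite -{1}[c]scale_permutation_id -moved_cube_id.
  have aE : (fun i : Idx => if i.1 \in [set: int]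
      then weighted_coef A alpha c i.1 i.2 `^ q else 0) = a.
    by apply/funext => i; rewrite in_setT.
  have idK : forall j : int, cancel (@id Zd) id by [].
  by rewrite (@esum_moved A alpha q (fun _ => id) (fun _ => id) c setT x q0 idK idK) aE.
apply: root_transfer => //; last exact: CP.
  by apply: integral_ge0 => x _; exact: poweR_ge0.
by apply: integral_ge0 => x _; exact: poweR_ge0.
Qed.

Lemma tl_norm_transfer_fin_inf (p : R) : 0 < p -> exists2 C : R, 0 <= C &
  forall c, (tl_norm B alpha p%:E +oo (P c) <= C%:E * tl_norm A alpha p%:E +oo c)%E.
Proof.
move=> p0; have [C C0 CP] := infinite_sup_comparison Au expA r1 mmoved moved_ball p0.
exists (C `^ p^-1); first exact: powR_ge0.
move=> c; pose w (i : Idx) := weighted_coef A alpha c i.1 i.2.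
have w0 i : 0 <= w i by exact: weighted_coef_ge0.
have supE (M : 'M[R]_n.+1) (F : Idx -> set (borel_cV R n.+1)) (c' : coef_seq R n) :
    (forall x, ereal_sup [set (weighted_term M alpha c' jk.1 jk.2 x)%:E
       | jk in [set: Idx]] = infinite_sup w F x) ->
    tl_norm M alpha p%:E +oo%E c' =
    ((\int[mu]_x (infinite_sup w F x `^ p)) `^ p^-1)%E.
  move=> E; rewrite /tl_norm unlock; congr (_ `^ _)%E.
  apply: eq_integral => x _; rewrite E gee0_abs//.
  apply: (@le_trans _ _ (w (0, 0) * \1_(F (0, 0)) x)%:E).
    by rewrite lee_fin mulr_ge0.
  by apply: ereal_sup_ubound; exists (0, 0).
rewrite (supE B (moved_cube B f)); last first.
  move=> x; congr ereal_sup; apply/seteqP; split => [_ [[j k] _ <-]|_ [[j k] _ <-]].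
    exists (j, g j k) => //=; rewrite -[in RHS](gf j k) weighted_term_moved//.
    by rewrite coefE.
  by exists (j, f j k) => //=; rewrite weighted_term_moved// coefE.
rewrite (supE A (borel_cube A)) => [|x]; last by [].
apply: root_transfer => //; last exact: CP.
  by apply: integral_ge0 => x _; exact: poweR_ge0.
by apply: integral_ge0 => x _; exact: poweR_ge0.
Qed.

Lemma tl_norm_transfer_inf_inf c :
  (tl_norm B alpha +oo +oo (P c) <= tl_norm A alpha +oo +oo c)%E.
Proof.
rewrite /tl_norm; apply: ge_ereal_sup => _ [[j k] _ <-] /=.
apply: ereal_sup_ubound; exists (j, g j k) => //=.
by rewrite -coefE /weighted_coef /scale_permutation.
Qed.

Lemma inverse_powers_bounded : exists2 b : R, 0 <= b &
  forall m : nat, mx_bounded b (A ^- m).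
Proof.
have [[//|L] _ LP] := expansive_pow_small Au expA (@ltr01 R).
have [a a0 Aa] := mx_bounded_exists A^-1.
have a1 : 1 <= Num.max 1 a by rewrite le_max lexx.
have Aa1 : mx_bounded (Num.max 1 a) A^-1.
  by apply: mx_boundedW Aa; rewrite le_max lexx orbT.
have da1 : 1 <= n.+1%:R * Num.max 1 a by rewrite mulr_ege1// ler1n.
exists ((n.+1%:R * Num.max 1 a) ^+ L); first by rewrite exprn_ge0// (le_trans _ da1).
move=> m; have [mL|mL] := leqP m L.
  rewrite -exprVn; apply: mx_boundedW (mx_boundedX m a1 Aa1).
  exact: ler_weXn2l.
by apply: mx_boundedW (LP m mL); exact: exprn_ege1.
Qed.

(** In the coordinates of scale l >= j the set of scale j has bounded diameter, because
the negative powers of A are bounded. *)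
Lemma moved_cube_in_window : exists N : nat, forall j k l k0, j <= l ->
  (exists2 x, dilated_cube B j (f j k) x & dilated_cube B l (f l k0) x) ->
  forall y, dilated_cube A j k y ->
    exists2 m, m \in lattice_window n N & dilated_cube A l (k0 + m) y.
Proof.
have [b b0 bP] := inverse_powers_bounded.
pose r2 := n.+1%:R * b * (1 + r) + r.
have r2N : r2 + 1 <= (Num.truncn (r2 + 1)).+1%:R by exact/ltW/truncnS_gt.
exists (Num.truncn (r2 + 1)).+1 => j k l k0 jl [x xj xl] y yj.
apply: (lattice_ball_cover Au r2N).
have xjA := BA xj; have xlA := BA xl.
have yjA := dilated_cube_lattice_ball Au (lexx 1) yj.
have [m lm] : exists m : nat, l = j + m%:Z.
  by exists `|l - j|%N; rewrite gez0_abs ?subr_ge0// [RHS]addrC subrK.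
have E (z : 'cV[R]_n.+1) : A ^ (- l) *m z = A ^- m *m (A ^ (- j) *m z).
  by rewrite mulmxA exprnN -[_ *m A ^ _]/(_ * _) -exprzDr// lm opprD addrC.
rewrite /lattice_ball /=.
have -> : A ^ (- l) *m y - map_mx intr k0 =
    A ^- m *m ((A ^ (- j) *m y - map_mx intr k) - (A ^ (- j) *m x - map_mx intr k)) +
    (A ^ (- l) *m x - map_mx intr k0).
  rewrite [- (_ - map_mx intr k)]opprB [_ + (map_mx intr k - _)]addrA subrK.
  by rewrite mulmxBr -!E addrA subrK.
by apply: mx_boundedD => //; apply: mx_boundedM => //; exact: mx_boundedB.
Qed.

(** For a B-cube P' of scale l, a moved cube of scale at most l that meets P' has
its A-cube covered by the window of A-cubes around P', so |moved cube| is at most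
D times the sum of the measures of the intersections of this A-cube with the
window. Summing the coefficients bounds the mean over P' by the means over the
window. *)
Lemma tl_norm_transfer_inf_fin (q : R) : 0 < q -> exists2 C : R, 0 <= C &
  forall c, (tl_norm B alpha +oo q%:E (P c) <= C%:E * tl_norm A alpha +oo q%:E c)%E.
Proof.
move=> q0.
have [N NP] := moved_cube_in_window.
pose s := lattice_window n N.
pose Nr := (Num.truncn (r + 1)).+1.
have rN : r + 1 <= Nr%:R by exact/ltW/truncnS_gt.
have [D D0 [DA DB]] : exists2 D : R, 0 <= D &
    (forall j k l, (mu (lattice_ball A r j k) <= D%:E * mu (dilated_cube A j l))%E) /\
    (forall j k l, (mu (lattice_ball B r j k) <= D%:E * mu (dilated_cube B j l))%E).
  exists (size (lattice_window n Nr))%:R => //.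
  by split=> j k l; [exact: (mu_lattice_ball_le j k l Au rN)|
    exact: (mu_lattice_ball_le j k l Bu rN)].
pose C := D * D * (size s)%:R; have C0 : 0 <= C by rewrite !mulr_ge0.
exists (C `^ q^-1); first exact: powR_ge0.
move=> c; set Z := tl_norm A alpha _ _ c.
have meanA0 (M : 'M[R]_n.+1) c' l m : (0 <= tl_cube_mean M alpha q c' l m)%E.
  rewrite mule_ge0 ?lee_fin ?invr_ge0 ?fine_ge0 ?measure_ge0//.
  apply: integral_ge0 => x _; apply: esum_ge0 => j _; apply: esum_ge0 => k _.
  by rewrite lee_fin powR_ge0.
have Z0 : (0 <= Z)%E.
  apply: (@le_trans _ _ (tl_cube_mean A alpha q c 0 0 `^ q^-1)%E); first exact: poweR_ge0.
  by apply: ereal_sup_ubound; exists (0, 0).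
have meanZ l m : (tl_cube_mean A alpha q c l m <= Z `^ q)%E.
  rewrite -[leLHS]poweRe1// -[X in (_ `^ X <= _)%E](mulVf (lt0r_neq0 q0)) poweRrM.
  apply: poweR_mono => //; first exact: poweR_ge0.
  by apply: ereal_sup_ubound; exists (l, m).
apply: ge_ereal_sup => _ [[l m'] _ <-] /=.
rewrite -[Z]poweRe1// -(divff (lt0r_neq0 q0)) poweRrM.
apply: root_transfer => //; first exact: poweR_ge0.
pose m := g l m'; have mE : m' = f l m by rewrite gf.
pose a (i : Idx) : R := if i.1 \in [set j | j <= l] then weighted_coef A alpha c i.1 i.2 `^ q else 0.
have a0 i : 0 <= a i by rewrite /a; case: ifP => // _; exact: powR_ge0.
have mcube (M : 'M[R]_n.+1) j k : M \in unitmx ->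
  measurable (dilated_cube M j k : set (borel_cV R n.+1)) by exact: measurable_dilated_cube.
pose P' : set (borel_cV R n.+1) := dilated_cube B l m'.
pose W (v : Zd) : set (borel_cV R n.+1) := dilated_cube A l (m + v).
have mP' : measurable P' by exact: mcube.
have mW v : measurable (W v) by exact: mcube.
have mQ (i : Idx) : measurable (borel_cube A i) by exact: mcube.
have int_sum (F : Idx -> set (borel_cV R n.+1)) X u : measurable X -> (forall i, measurable (F i)) ->
    (\int[mu]_(x in X) (weighted_sum a F u x)%:E = \sum_(i <- u) (a i)%:E * mu (F i `&` X))%E.
  move=> mX mF; rewrite /weighted_sum.
  under eq_integral do rewrite -sumEFin.
  rewrite ge0_integral_sum//; last 2 first.
  - move=> i; apply/measurable_EFinP/measurable_funTS.
    by apply: measurable_funM; [exact: measurable_cst|exact: measurable_indic].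
  - by move=> i x _; rewrite lee_fin mulr_ge0.
  apply: eq_bigr => i _; under eq_integral do rewrite EFinM.
  rewrite ge0_integralZl ?lee_fin//; first by rewrite integral_indic.
  by apply/measurable_EFinP/measurable_funTS; exact: measurable_indic.
have sum_ge0 (F : Idx -> set (borel_cV R n.+1)) u X :
    (0 <= \sum_(i <- u) (a i)%:E * mu (F i `&` X))%E.
  by apply: sume_ge0 => i _; rewrite mule_ge0 ?lee_fin.
have term i : ((a i)%:E * mu (moved_cube B f i `&` P') <=
    D%:E * \sum_(v <- s) (a i)%:E * mu (borel_cube A i `&` W v))%E.
  have rhs0 : (0 <= D%:E * \sum_(v <- s) (a i)%:E * mu (borel_cube A i `&` W v))%E.
    by rewrite mule_ge0 ?lee_fin// sume_ge0// => v _; rewrite mule_ge0 ?lee_fin.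
  have [il|il] := boolP (i.1 \in [set j | j <= l]); last first.
    have ai0 : a i = 0 by rewrite /a (negbTE il).
    by apply: le_trans rhs0; rewrite ai0 mul0e.
  have [meet|nomeet] := pselect (exists2 x, moved_cube B f i x & P' x); last first.
    rewrite (_ : moved_cube B f i `&` P' = set0) ?measure0 ?mule0//.
    by rewrite -subset0 => x [x1 x2]; apply: nomeet; exists x.
  rewrite -ge0_sume_distrr; last by move=> v _; exact: measure_ge0.
  rewrite muleCA; apply: lee_wpmul2l; first by rewrite lee_fin.
  apply: (@le_trans _ _ (mu (lattice_ball A r i.1 i.2))).
    apply: le_measure; rewrite ?inE; [exact: measurableI|exact: measurable_lattice_ball|].
    by move=> x [+ _]; exact: moved_ball.
  apply: (le_trans (DA i.1 i.2 i.2)).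
  apply: lee_wpmul2l; first by rewrite lee_fin.
  apply: measure_cover_le => [||x xi].
  - exact: mQ.
  - by move=> v; exact: measurableI.
  move: il; rewrite inE /= => il; move: meet; rewrite /P' mE => meet.
  by have [v vs xv] := NP i.1 i.2 l m il meet x xi; exists v.
have integral_le : (\int[mu]_(x in P') infinite_sum a (moved_cube B f) x <=
    D%:E * \sum_(v <- s) \int[mu]_(x in W v) infinite_sum a (borel_cube A) x)%E.
  have [_ + _] := infinite_sum_integral1 mP' a0 mmoved; apply => u.
  rewrite int_sum//.
  apply: (@le_trans _ _ (\sum_(i <- enum_upto Idx u)
      D%:E * \sum_(v <- s) (a i)%:E * mu (borel_cube A i `&` W v))%E).
    by apply: lee_sum => i _; exact: term.
  rewrite -ge0_sume_distrr; last first.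
    by move=> i _; rewrite sume_ge0// => v _; rewrite mule_ge0 ?lee_fin.
  apply: lee_wpmul2l; first by rewrite lee_fin.
  rewrite exchange_big /=; apply: lee_sum => v _; rewrite -int_sum//.
  by have [_ _] := infinite_sum_integral1 (mW v) a0 mQ; apply.
have [p' p'0 cubeB] := mu_dilated_cubeE l Bu.
have [w w0 cubeA] := mu_dilated_cubeE l Au.
have wp' : w <= D * p'.
  rewrite -lee_fin EFinM -(cubeB m') -(cubeA m).
  apply: le_trans (DB l m' m').
  apply: le_measure; rewrite ?inE; [exact: mcube|exact: measurable_lattice_ball|].
  by rewrite mE; exact: AB.
have meanA v : (\int[mu]_(x in W v) infinite_sum a (borel_cube A) x <= w%:E * Z `^ q)%E.
  apply: (@le_trans _ _ (w%:E * tl_cube_mean A alpha q c l (m + v))%E); last first.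
    by apply: lee_wpmul2l; [rewrite lee_fin ltW|exact: meanZ].
  rewrite /tl_cube_mean (cubeA (m + v)) /= muleA -EFinM divff ?gt_eqF// mul1e.
  suff -> : (fun x => \esum_(j in [set j : int | (j <= l)%R]) \esum_(k in [set: Zd])
      (weighted_term A alpha c j k x `^ q)%:E)%E = infinite_sum a (borel_cube A) by [].
  apply/funext => x; rewrite -{1}[c]scale_permutation_id -moved_cube_id.
  have idK : forall j : int, cancel (@id Zd) id by [].
  by rewrite (@esum_moved A alpha q (fun _ => id) (fun _ => id) c [set j | j <= l] x q0 idK idK).
have -> : tl_cube_mean B alpha q (P c) l m' =
    (p'^-1%:E * \int[mu]_(x in P') infinite_sum a (moved_cube B f) x)%E.
  rewrite /tl_cube_mean (cubeB m') /=.
  suff -> : (fun x => \esum_(j in [set j : int | (j <= l)%R]) \esum_(k in [set: Zd])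
      (weighted_term B alpha (P c) j k x `^ q)%:E)%E =
      infinite_sum a (moved_cube B f) by [].
  have aE : (fun i : Idx => if i.1 \in [set j | j <= l]
      then weighted_coef B alpha c i.1 i.2 `^ q else 0) = a.
    by apply/funext => i; rewrite coefE.
  apply/funext => x.
  by rewrite (esum_moved B alpha c [set j | j <= l] x q0 fg gf) aE.
exact: (average_bound p'0 w0 D0 wp' (poweR_ge0 Z q) meanA integral_le).
Qed.

Lemma tl_norm_transfer (p q : \bar R) : (0 < p)%E -> (0 < q)%E -> exists2 C : R, 0 <= C &
  forall c, (tl_norm B alpha p q (P c) <= C%:E * tl_norm A alpha p q c)%E.
Proof.
case: p => [p| |]//; case: q => [q| |]//.
- by rewrite !lte_fin; exact: tl_norm_transfer_fin_fin.
- by rewrite lte_fin => p0 _; exact: tl_norm_transfer_fin_inf.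
- by rewrite lte_fin => _; exact: tl_norm_transfer_inf_fin.
- by move=> _ _; exists 1 => // c; rewrite mul1e; exact: tl_norm_transfer_inf_inf.
Qed.

End transfer.

Lemma tl_norm_ge0 A (alpha : R) (p q : \bar R) c : (0 <= tl_norm A alpha p q c)%E.
Proof.
case: p => [p| |]; case: q => [q| |]; rewrite /tl_norm ?unlock ?poweR_ge0//.
- apply: (@le_trans _ _ (tl_cube_mean A alpha q c 0 0 `^ q^-1)%E); first exact: poweR_ge0.
  by apply: ereal_sup_ubound; exists (0, 0).
- apply: (@le_trans _ _ (weighted_coef A alpha c 0 0)%:E).
    by rewrite lee_fin weighted_coef_ge0.
  by apply: ereal_sup_ubound; exists (0, 0).
Qed.

End norm_transfer.

(** * The permutations *)

(** pi_j is the permutation close to B^-j A^j. If B^-j x is within 1 of pi_j k, then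
A^-j x - k = A^-j B^j ((B^-j x - pi_j k) - (T_j k - pi_j k)) is bounded. *)
Lemma cubes_comparable (R : realType) (n : nat) (A B : 'M[R]_n.+1) :
  A \in unitmx -> B \in unitmx -> expansive A -> expansive B ->
  equivalent_matrices A B -> `|\det A| = `|\det B| ->
  exists (r : R) (f g : int -> 'cV[int]_n.+1 -> 'cV[int]_n.+1),
    [/\ 1 <= r, forall j, cancel (f j) (g j), forall j, cancel (g j) (f j),
      forall j k, dilated_cube B j (f j k) `<=` lattice_ball A r j k &
      forall j k, dilated_cube A j k `<=` lattice_ball B r j (f j k)].
Proof.
move=> Au Bu expA expB AB detAB.
have [K KP] := equivalent_matrices_bounded Au Bu expA expB AB detAB.
have [s near] := uniformly_near_det1 n K.
pose T j := B ^ (- j) *m A ^ j.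
have bij j : exists fg : ('cV[int]_n.+1 -> 'cV[int]_n.+1) * ('cV[int]_n.+1 -> 'cV[int]_n.+1),
    [/\ cancel fg.1 fg.2, cancel fg.2 fg.1 &
      forall k, mx_bounded s (T j *m map_mx intr k - map_mx intr (fg.1 k))].
  have [|[f [g fgP]] _] := near (T j); last by exists (f, g).
  split; first by have [] := KP j.
  have dB0 : `|\det B| != 0 by rewrite normr_eq0 -unitfE.
  have norm_exprz (x : R) (z : int) : `|x ^ z| = `|x| ^ z.
    case: z => m; first exact: normrX.
    by rewrite -[x ^ _]/(x ^- m.+1) normfV normrX.
  rewrite det_mulmx !det_exprz normrM !norm_exprz detAB -expfzDr// addNr.
  exact: expr0z.
have [F FP] := choice bij.
have K0 : 0 <= K by have [h _] := KP 0; exact: le_trans (normr_ge0 _) (h 0 0).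
have s0 : 0 <= s by have [_ _ h] := FP 0; exact: le_trans (normr_ge0 _) (h 0 0 0).
pose r := 1 + n.+1%:R * K * (1 + s) + s.
have nKs0 : 0 <= n.+1%:R * K * s by rewrite !mulr_ge0.
have nK0 : 0 <= n.+1%:R * K by rewrite mulr_ge0.
exists r, (fun j => (F j).1), (fun j => (F j).2); split.
- by rewrite /r mulrDr mulr1; lra.
- by move=> j; have [] := FP j.
- by move=> j; have [] := FP j.
- move=> j k x xB; have [_ _ /(_ k) Fk] := FP j; have [K'j _] := KP j.
  have x1 := dilated_cube_lattice_ball Bu (lexx 1) xB.
  apply: (@mx_boundedW _ _ _ (n.+1%:R * K * (1 + s))).
    by rewrite /r; lra.
  have -> : A ^ (- j) *m x - map_mx intr k = (A ^ (- j) *m B ^ j) *m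
      ((B ^ (- j) *m x - map_mx intr ((F j).1 k)) -
       (T j *m map_mx intr k - map_mx intr ((F j).1 k))).
    rewrite [- (_ - map_mx intr ((F j).1 k))]opprB.
    rewrite [_ + (map_mx intr ((F j).1 k) - _)]addrA subrK mulmxBr.
    by rewrite -!mulmxA !mulmx_exprz// mulmx_exprzV.
  by apply: mx_boundedM => //; exact: mx_boundedB.
- move=> j k x xA; have [_ _ /(_ k) Fk] := FP j; have [Kj' Kj] := KP j.
  have x1 := dilated_cube_lattice_ball Au (lexx 1) xA.
  apply: (@mx_boundedW _ _ _ (n.+1%:R * K * 1 + s)).
    by rewrite /r mulrDr mulr1; lra.
  have -> : B ^ (- j) *m x - map_mx intr ((F j).1 k) =
      T j *m (A ^ (- j) *m x - map_mx intr k) +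
      (T j *m map_mx intr k - map_mx intr ((F j).1 k)).
    by rewrite mulmxBr addrA subrK /T -!mulmxA mulmx_exprz.
  by apply: mx_boundedD => //; exact: mx_boundedM.
Qed.

Theorem theorem5p7 (R : realType) (n : nat) (alpha : R) (p q : \bar R)
    (A B : 'M[R]_n.+1) :
  (0 < p)%E -> (0 < q)%E ->
  A \in unitmx -> B \in unitmx ->
  expansive A -> expansive B ->
  equivalent_matrices A B ->
  `|\det A| = `|\det B| ->
  exists pi pi_inv : int -> 'cV[int]_n.+1 -> 'cV[int]_n.+1,
    (forall j, cancel (pi j) (pi_inv j) /\ cancel (pi_inv j) (pi j)) /\
    (let P : coef_seq R n -> coef_seq R n := scale_permutation pi_inv in
     P @` tl_space A alpha p q = tl_space B alpha p q /\
     exists2 C : R, 1 <= C &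
       forall c : coef_seq R n,
         (C^-1%:E * tl_norm A alpha p q c <= tl_norm B alpha p q (P c) /\
          tl_norm B alpha p q (P c) <= C%:E * tl_norm A alpha p q c)%E).
Proof.
move=> p0 q0 Au Bu expA expB AB detAB.
have [r [f [g [r1 fg gf BA BA']]]] := cubes_comparable Au Bu expA expB AB detAB.
have [C1 C10 C1P] := tl_norm_transfer alpha Au Bu expA r1 detAB fg gf BA BA' p0 q0.
have [||C2 C20 C2P] := tl_norm_transfer alpha Bu Au expB r1 (esym detAB) gf fg _ _ p0 q0.
  by move=> j k; have := @BA' j (g j k); rewrite gf.
  by move=> j k; have := @BA j (g j k); rewrite gf.
have PK c : scale_permutation f (scale_permutation g c) = c.
  by apply/funext => -[j k]; rewrite /scale_permutation /= fg.
have KP c : scale_permutation g (scale_permutation f c) = c.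
  by apply/funext => -[j k]; rewrite /scale_permutation /= gf.
pose C := Num.max 1 (Num.max C1 C2).
have C0 : 0 < C by rewrite lt_max ltr01.
have upper c : (tl_norm B alpha p q (scale_permutation g c) <= C%:E * tl_norm A alpha p q c)%E.
  apply: (le_trans (C1P c)); apply: lee_wpmul2r; first exact: tl_norm_ge0.
  by rewrite lee_fin !le_max lexx orbT.
have lower c : (tl_norm A alpha p q c <= C%:E * tl_norm B alpha p q (scale_permutation g c))%E.
  rewrite -{1}[c]PK; apply: (le_trans (C2P _)).
  apply: lee_wpmul2r; first exact: tl_norm_ge0.
  by rewrite lee_fin !le_max lexx !orbT.
exists f, g; split; first by [].
split; last first.
  exists C => [|c]; first by rewrite le_max lexx.
  by split; [rewrite lee_pdivrMl//; exact: lower|exact: upper].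
apply/seteqP; split => [_ [c cA <-]|c cB].
  apply: (le_lt_trans (upper c)); apply: lte_mul_pinfty => //.
  by rewrite lee_fin ltW.
exists (scale_permutation f c); last exact: KP.
have := lower (scale_permutation f c); rewrite KP => h.
apply: (le_lt_trans h); apply: lte_mul_pinfty => //.
by rewrite lee_fin ltW.
Qed.
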